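(* Let a domain $\Omega\subset\mathbb{R}^2$ of the $(t,x)$-plane be divided by a smooth curve $\gamma_t=\{(t,x): x=\Phi(t)\}$ into a left part $\Omega_-$ and a right part $\Omega_+$. Let the triple of distributions $(V,E,n)$ of the form $$V=V_-+[V]\,\Theta(x-\Phi(t)),\qquad E=E_-+[E]\,\Theta(x-\Phi(t)),\qquad n=\hat n+e(t)\,\delta(x-\Phi(t)),$$ together with the curve $\gamma_t$, be a generalized strongly singular solution (in the sense defined in the context) of the system $$n_t+(Vn)_x=0,\qquad \left(\frac{nV^2}{2}+\frac{E^2}{2}\right)_t+\left(\frac{nV^3}{2}\right)_x=0 .$$ Then this solution satisfies, along $\gamma_t$, the following analogue of the Rankine-Hugoniot conditions: $$\frac{d}{dt}e(t)=\Big(-[\hat n V]+[\hat n]\,\dot\Phi(t)\Big)\Big|_{x=\Phi(t)},$$ $$\frac{d}{dt}\,\frac{e(t)(\dot\Phi(t))^2}{2}=\left(-\left[\frac{\hat n V^3}{2}\right]+\left[\frac{\hat n V^2+E^2}{2}\right]\dot\Phi(t)\right)\Big|_{x=\Phi(t)} .$$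
   Context: Here $t\ge 0$, $x\in\mathbb{R}$, $\Theta$ is the Heaviside function, $\delta$ the Dirac delta function, and $\dot\Phi=d\Phi/dt$. Form of the distributions. A curve $\gamma=\{x=\Phi(t)\}$, $t\ge0$, with $\Phi(0)=0$, $\Phi\in C^1$, is given. For each of the quantities $f=V,E,\hat n$ (and expressions formed from them), $f_-$ and $f_+$ denote the values of $f$ to the left ($x<\Phi(t)$) and to the right ($x>\Phi(t)$) of $\gamma$; $f_\pm$ are differentiable functions having one-sided limits on $\gamma$, and $[f]=f_+-f_-$. Thus $V=V_\pm$ and $E=E_\pm$ on the two sides of $\gamma$. Further, $\hat n(t,x)=1-\{E_x(t,x)\}$, where $\{E_x\}$ is the derivative of $E$ at the points where it exists in the usual sense, and $e(t)=-[E(t,x)]|_{x=\Phi(t)}$. The initial data are denoted $V^0(x)=V(0,x)$, $E^0(x)=E(0,x)$, $\hat n^0(x)=\hat n(0,x)$. Curve integrals and delta-derivative. $\int_\gamma \cdot\, dl$ is the curvilinear integral along $\gamma$ with respect to arclength. For a test function $\phi$, the delta-derivative is the tangential derivative along the curve: $$\frac{\delta\phi(t,x)}{\delta t}\Big|_\gamma=\Big(\phi_t+\dot\Phi(t)\phi_x\Big)\Big|_\gamma=\frac{d\,\phi(t,\Phi(t))}{dt}.$$ Definition (generalized strongly singular solution). The triple $(V,E,n)$ of the form $V=V_-+[V]\,\Theta(x-\Phi(t))$, $E=E_-+[E]\,\Theta(x-\Phi(t))$, $n=\hat n+e(t)\,\delta(x-\Phi(t))$ and the curve $\gamma$ are called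 a generalized strongly singular solution of the system $$n_t+(Vn)_x=0,\qquad \left(\tfrac{nV^2}{2}+\tfrac{E^2}{2}\right)_t+\left(\tfrac{nV^3}{2}\right)_x=0$$ with initial data $V^0(x)$, $E^0(x)$, $n^0(x)=\hat n^0(x)+e(0)\delta(x)$, if for all test functions $\phi(t,x)\in\mathcal{D}(\mathbb{R}\times[0,\infty))$ (smooth, compactly supported, with $x\in\mathbb{R}$, $t\in[0,\infty)$) $$\int_0^\infty\!\!\int_{\mathbb{R}}\hat n(\phi_t+V\phi_x)\,dx\,dt+\int_\gamma e(t)\frac{\delta\phi}{\delta t}\frac{dl}{\sqrt{1+(\dot\Phi(t))^2}}+\int_{\mathbb{R}}\hat n^0(x)\phi(0,x)\,dx+e(0)\phi(0,0)=0,$$ $$\int_0^\infty\!\!\int_{\mathbb{R}}\left(\Big(\frac{\hat nV^2}{2}+\frac{E^2}{2}\Big)\phi_t+\frac{\hat nV^3}{2}\phi_x\right)dx\,dt+\int_\gamma\frac{e(t)(\dot\Phi(t))^2}{2}\frac{\delta\phi}{\delta t}\frac{dl}{\sqrt{1+(\dot\Phi(t))^2}}$$ $$+\int_{\mathbb{R}}\left(\frac{\hat n^0(x)(V^0(x))^2}{2}+\frac{(E^0(x))^2}{2}\right)\phi(0,x)\,dx+\frac{e(0)(\dot\Phi(0))^2}{2}\phi(0,0)=0.$$ *)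

(* Defs.v *)
(* MathComp-Analysis.  Points of the plane are pairs p = (t, x) : R * R. *)
From HB Require Import structures.
From mathcomp Require Import all_boot all_order all_algebra.
From mathcomp Require Import all_classical all_reals all_analysis.
Set Implicit Arguments.
Unset Strict Implicit.
Unset Printing Implicit Defensive.
Import Order.TTheory GRing.Theory Num.Theory.
Import numFieldNormedType.Exports.
Local Open Scope classical_set_scope.
Local Open Scope ring_scope.

(* Time derivative of a function on [0, +oo[: two-sided for t > 0 and
   one-sided at t = 0.  Values of f at negative times play no role. *)
Definition is_dt (R : realType) (f : R -> R) (t l : R) : Prop :=
  (f s - f t) / (s - t) @[s --> within [set s | 0 <= s] t^'] --> l.

Definition dt (R : realType) (f : R -> R) (t : R) : R :=
  lim ((f s - f t) / (s - t) @[s --> within [set s | 0 <= s] t^']).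

Definition C1_halfline (R : realType) (f : R -> R) : Prop :=
  (forall t, 0 <= t -> is_dt f t (dt f t)) /\
  {within `[0, +oo[, continuous (dt f)}.

Definition pd_t (R : realType) (f : R * R -> R) : R * R -> R :=
  fun p => 'D_(1, 0) f p.

Definition pd_x (R : realType) (f : R * R -> R) : R * R -> R :=
  fun p => 'D_(0, 1) f p.

Fixpoint is_Ck (R : realType) (k : nat) (f : R * R -> R) : Prop :=
  continuous f /\
  (if k is k'.+1 then
     [/\ forall p, derivable f p (1, 0), forall p, derivable f p (0, 1),
         is_Ck k' (pd_t f) & is_Ck k' (pd_x f)]
   else True).

(* A test function on [0, +oo[ x R (not required to vanish at t = 0) is the
   restriction to t >= 0 of a compactly supported smooth function on the
   plane. *)
Definition test_function (R : realType) (phi : R * R -> R) : Prop :=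
  (forall k, is_Ck k phi) /\ compact (closure [set p | phi p != 0]).

Definition half_plane (R : realType) : set (R * R) := [set p | 0 <= p.1].

Definition left_side (R : realType) (Phi : R -> R) : set (R * R) :=
  [set p | 0 <= p.1 /\ p.2 < Phi p.1].

Definition right_side (R : realType) (Phi : R -> R) : set (R * R) :=
  [set p | 0 <= p.1 /\ Phi p.1 < p.2].

(* Differentiability of the restriction of f to D; at an interior point of D
   it is differentiability of f, at a point with t = 0 it is one-sided. *)
Definition differentiable_on (R : realType) (D : set (R * R))
    (f : R * R -> R) : Prop :=
  forall p, D p ->
  exists2 g : R * R -> R, differentiable g p & forall q, D q -> g q = f q.

Definition left_nbhs (R : realType) (Phi : R -> R) (t : R) :=
  within (left_side Phi) (nbhs (t, Phi t)).

Definition right_nbhs (R : realType) (Phi : R -> R) (t : R) :=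
  within (right_side Phi) (nbhs (t, Phi t)).

(* f_- and f_+ are differentiable and have one-sided limits on the curve. *)
Definition piecewise_differentiable (R : realType) (Phi : R -> R)
    (f : R * R -> R) : Prop :=
  [/\ differentiable_on (left_side Phi) f,
      differentiable_on (right_side Phi) f &
      forall t, 0 <= t ->
        cvg (f @ left_nbhs Phi t) /\ cvg (f @ right_nbhs Phi t)].

(* [f] = f_+ - f_- at the point (t, Phi t) of the curve. *)
Definition jump (R : realType) (Phi : R -> R) (f : R * R -> R) (t : R) : R :=
  lim (f @ right_nbhs Phi t) - lim (f @ left_nbhs Phi t).

Definition Heaviside (R : realType) (x : R) : R := if 0 <= x then 1 else 0.

(* Integral over the curve, with respect to arclength, of the function whose
   value at the point (t, Phi t) is g t. *)
Definition curve_integral (R : realType) (Phi g : R -> R) : R :=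
  \int[lebesgue_measure]_(t in `[0, +oo[)
    (g t * Num.sqrt (1 + dt Phi t ^+ 2)).

Definition delta_derivative (R : realType) (Phi : R -> R) (phi : R * R -> R)
    (t : R) : R :=
  pd_t phi (t, Phi t) + dt Phi t * pd_x phi (t, Phi t).

Definition half_plane_integral (R : realType) (f : R * R -> R) : R :=
  \int[lebesgue_measure]_(t in `[0, +oo[)
    \int[lebesgue_measure]_(x in [set: R]) f (t, x).

(* The singular component n = nh + e(t) delta(x - Phi(t)) is represented by its
   regular part nh and its amplitude e. *)
Definition generalized_solution (R : realType) (Phi : R -> R)
    (V E nh : R * R -> R) (e : R -> R) (V0 E0 nh0 : R -> R) : Prop :=
  forall phi : R * R -> R, test_function phi ->
  half_plane_integral (fun p => nh p * (pd_t phi p + V p * pd_x phi p))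
  + curve_integral Phi (fun t =>
      e t * delta_derivative Phi phi t / Num.sqrt (1 + dt Phi t ^+ 2))
  + \int[lebesgue_measure]_(x in [set: R]) (nh0 x * phi (0, x))
  + e 0 * phi (0, 0) = 0
  /\
  half_plane_integral (fun p =>
      (nh p * V p ^+ 2 / 2 + E p ^+ 2 / 2) * pd_t phi p
      + nh p * V p ^+ 3 / 2 * pd_x phi p)
  + curve_integral Phi (fun t =>
      e t * dt Phi t ^+ 2 / 2 * delta_derivative Phi phi t
      / Num.sqrt (1 + dt Phi t ^+ 2))
  + \int[lebesgue_measure]_(x in [set: R])
      ((nh0 x * V0 x ^+ 2 / 2 + E0 x ^+ 2 / 2) * phi (0, x))
  + e 0 * dt Phi 0 ^+ 2 / 2 * phi (0, 0) = 0.

(* Main.v *)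
(* Both equations say that, for all test functions phi,
     int int (P phi_t + Q phi_x) dx dt + int g(t) (d/dt) phi(t, Phi(t)) dt + (data) = 0
   with (P, Q, g) = (nh, nh V, e), resp. ((nh V^2 + E^2)/2, nh V^3/2, e Phi'^2/2).
   P and Q are merely continuous off the curve with one-sided limits on it, so instead
   of integrating by parts on each side we differentiate g by hand at a time t0: with
   c = Phi'(t0) and h small, take phi(t,x) = psi(t) chi(x - Phi(t0) - c (t - t0)),
   where psi approximates the indicator of an interval ]a, b[ within h of t0 and chi is a
   plateau of width O(delta h) which, Phi being differentiable at t0, equals 1 on the
   curve.  The psi' term of the double integral is O(delta h), and since chi' has
   integral 1 on the left of the curve and -1 on its right the chi' term is
   (b - a) (-[Q] + c [P]) + o(h); hence g(b) - g(a) = (b - a) (-[Q] + c [P]) + o(h).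
   Keeping a > 0 removes the initial data; t0 = 0 follows by continuity of g. *)
Require Import Defs.
From HB Require Import structures.
From mathcomp Require Import all_boot all_order all_algebra.
From mathcomp Require Import all_classical all_reals all_analysis.
From mathcomp Require Import measurable_realfun ring lra.
Import Order.TTheory GRing.Theory Num.Theory.
Import numFieldNormedType.Exports.
Local Open Scope classical_set_scope.
Local Open Scope ring_scope.

Set Implicit Arguments.
Unset Strict Implicit.
Unset Printing Implicit Defensive.

(** * Smooth cut-offs *)

Lemma expn_expR_bounded (R : realType) (n : nat) (y : R) :
  0 <= y -> y ^+ n * expR (- y) <= n`!%:R.
Proof.
move=> y0; rewrite expRN ler_pdivrMr ?expR_gt0//.
case: n => [|n]; first by rewrite expr0 fact0 mul1r -expR0 ler_expR.
rewrite -ler_pdivrMl ?ltr0n ?fact_gt0// mulrC.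
by apply: le_trans (expR_ge1Dxn n y0); rewrite lerDr.
Qed.

(** Since $y^i e^{-y} \le i!$ for every $i$, the sum $\sum_i |P_i|\, i!$ is a bound. *)
Lemma poly_expR_bounded (R : realType) (P : {poly R}) :
  exists K : R, forall y, 0 <= y -> `|P.[y]| * expR (- y) <= K.
Proof.
exists (\sum_(i < size P) `|P`_i| * i`!%:R) => y y0.
rewrite horner_coef; apply: (@le_trans _ _
  ((\sum_(i < size P) `|P`_i * y ^+ i|) * expR (- y))).
  by rewrite ler_wpM2r ?expR_ge0// ler_norm_sum.
rewrite mulr_suml; apply: ler_sum => i _.
rewrite normrM (ger0_norm (exprn_ge0 _ y0)) -mulrA ler_wpM2l//.
exact: expn_expR_bounded.
Qed.

(* The functions P(1/x) exp(-1/x), extended by 0 to x <= 0: a class stable under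
   differentiation, all of whose members are smooth. *)
Definition flat (R : realType) (P : {poly R}) (x : R) : R :=
  if 0 < x then P.[x^-1] * expR (- x^-1) else 0.

Lemma flat_le0 (R : realType) (P : {poly R}) (x : R) : x <= 0 -> flat P x = 0.
Proof. by rewrite /flat leNgt => /negbTE ->. Qed.

Lemma flat1_gt0 (R : realType) (x : R) : 0 < x -> 0 < flat (1 : {poly R}) x.
Proof. by move=> x0; rewrite /flat x0 hornerC mul1r expR_gt0. Qed.

Lemma flat1_ge0 (R : realType) (x : R) : 0 <= flat (1 : {poly R}) x.
Proof. by case: (ltP 0 x) => x0; [exact/ltW/flat1_gt0|rewrite flat_le0]. Qed.

(** The quadratic bound makes the difference quotient of [flat P] at 0 of order $|x|$, which gives
    the derivative 0 there. It comes from bounding $y^2 P(y) e^{-y}$ at $y = 1/x$. *)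
Lemma flat_bounded (R : realType) (P : {poly R}) :
  exists K : R, forall x, `|flat P x| <= K * x ^+ 2.
Proof.
have [K HK] := poly_expR_bounded (P * 'X ^+ 2).
have K0 : 0 <= K by apply: le_trans (HK 0 (lexx 0)); rewrite mulr_ge0 ?expR_ge0.
exists K => x; rewrite /flat; case: ifPn => x0; last by rewrite normr0 mulr_ge0 ?sqr_ge0.
rewrite -ler_pdivrMr ?exprn_gt0//.
have xV0 : 0 <= x^-1 by rewrite invr_ge0 ltW.
have := HK _ xV0; rewrite hornerM hornerXn normrM (ger0_norm (exprn_ge0 _ xV0)).
by rewrite normrM (ger0_norm (expR_ge0 _)) exprVn mulrAC.
Qed.

Lemma near_eq_is_derive_eq (R : numFieldType) (V W : normedModType R)
    (f g : V -> W) (a v : V) (df dg : W) :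
  (\near a, f a = g a) -> df = dg -> is_derive a v f df -> is_derive a v g dg.
Proof. by move=> fg <-; exact: near_eq_is_derive. Qed.

(** For $x > 0$ put $y = 1/x$: then $y' = -y^2$, and $P(y) e^{-y}$ has derivative $y^2 (P(y) -
    P'(y)) e^{-y}$, again of the same form. *)
Lemma is_derive_flat (R : realType) (P : {poly R}) (x : R) :
  is_derive x 1 (flat P) (flat ('X ^+ 2 * (P - P^`())) x).
Proof.
have [x0|x0|->] := ltgtP x 0.
- rewrite (flat_le0 _ (ltW x0)); apply: (@near_eq_is_derive _ _ _ (cst 0)).
  by near=> y; rewrite flat_le0//; apply: ltW; near: y; exact: lt_nbhsl.
- have dV : is_derive x 1 (fun y : R => y^-1) (- x ^- 2).
    apply: is_derive_eq; first by apply: is_deriveV; rewrite gt_eqF.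
    by rewrite /GRing.scale/= mulr1.
  have dP : is_derive x 1 (horner P \o (fun y : R => y^-1)) (P^`().[x^-1] * (- x ^- 2)).
    exact: is_derive1_comp.
  have dN : is_derive x 1 (fun y : R => - y^-1) (x ^- 2).
    by rewrite -[X in is_derive _ _ _ X]opprK; exact: is_deriveN.
  have dE : is_derive x 1 (expR \o (fun y : R => - y^-1)) (expR (- x^-1) * x ^- 2).
    exact: is_derive1_comp.
  have := is_deriveM dP dE; apply: near_eq_is_derive_eq.
    by near=> y; rewrite /flat ifT//; near: y; exact: lt_nbhsr.
  rewrite /flat x0 /GRing.scale/= hornerM hornerD hornerN hornerXn exprVn; ring.
- rewrite flat_le0//.
  have [K HK] := flat_bounded P.
  suff h : (fun h => h^-1 *: ((flat P \o shift 0) (h *: 1) - flat P 0)) @ 0^' --> (0 : R).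
    apply: DeriveDef; first by apply/cvg_ex; exists 0.
    exact: cvg_lim h.
  apply/norm_cvg0P.
  have : (fun h : R => K * `|h|) @ 0^' --> (0 : R).
    rewrite -[X in _ --> X](mulr0 K); apply: cvgM; first exact: cvg_cst.
    by rewrite -[X in _ --> X](@normr0 R R); apply: cvg_norm; exact: nbhs_dnbhs.
  apply: (squeeze_cvgr _ (cvg_cst 0)).
  near=> h.
  have h0 : h != 0 by near: h; exact: nbhs_dnbhs_neq.
  rewrite normr_ge0/= (@flat_le0 _ P 0)// subr0 addr0 /GRing.scale/= mulr1.
  rewrite normrM normfV ler_pdivrMl ?normr_gt0//.
  by rewrite mulrC -mulrA -expr2 real_normK ?num_real.
Unshelve. all: by end_near. Qed.

Lemma continuous_flat (R : realType) (P : {poly R}) : continuous (flat P).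
Proof.
move=> x; apply/differentiable_continuous/derivable1_diffP.
by have [] := is_derive_flat P x.
Qed.

(** * Directional derivatives and the classes $C^k$ in the plane *)

Lemma is_derive_line (R : numFieldType) (V W : normedModType R) (f : V -> W)
    (p v : V) (df : W) :
  is_derive (0 : R) 1 (fun h : R => f (h *: v + p)) df -> is_derive p v f df.
Proof.
move=> [h1 h2]; apply: DeriveDef; first exact/derivable1P.
rewrite -h2 /derive.
set g1 := (X in lim (X @ _)); set g2 := (X in _ = lim (X @ _)).
suff -> : g1 = g2 by [].
by apply/funext => h; rewrite /g1 /g2 /= addr0 scale0r add0r [_%:A]mulr1.
Qed.

(** On the line $h \mapsto p + hv$ the argument of [F] is affine in $h$, with slope $\alpha v_1 +
    \beta v_2$, so the one-variable chain rule applies. *)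
Lemma is_derive_comp_affine (R : realType) (F : R -> R) (dF : R) (al be ga : R)
    (p v : R * R) :
  is_derive (al * p.1 + be * p.2 + ga) 1 F dF ->
  is_derive p v (fun q => F (al * q.1 + be * q.2 + ga))
    ((al * v.1 + be * v.2) * dF).
Proof.
move=> HF; apply: is_derive_line; rewrite /=.
pose m := al * v.1 + be * v.2; pose b := al * p.1 + be * p.2 + ga.
have -> : (fun h : R => F (al * (h * v.1 + p.1) + be * (h * v.2 + p.2) + ga)) =
    F \o (fun h : R => h * m + b).
  by apply/funext => h /=; congr F; rewrite /m /b; ring.
have dm : is_derive (0 : R) 1 (fun h : R => h * m + b) m.
  have := is_deriveD (is_deriveM (is_derive_id (0 : R) 1) (is_derive_cst m (0 : R) 1))
    (is_derive_cst b (0 : R) 1).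
  by move=> d; apply: (is_derive_eq d); rewrite /GRing.scale/= mulr0 add0r mulr1 addr0.
have dF0 : is_derive ((fun h : R => h * m + b) 0) 1 F dF by rewrite mul0r add0r.
by rewrite -/m mulrC; exact: (@is_derive1_comp _ F (fun h : R => h * m + b)).

Qed.

Lemma is_CkS_intro (R : realType) (k : nat) (f ft fx : R * R -> R) :
  continuous f ->
  (forall p : R * R, is_derive p ((1, 0) : R * R) f (ft p)) ->
  (forall p : R * R, is_derive p ((0, 1) : R * R) f (fx p)) ->
  is_Ck k ft -> is_Ck k fx -> is_Ck k.+1 f.
Proof.
move=> cf dt dx ct cx; split; first exact: cf.
split.
- by move=> p; have [] := dt p.
- by move=> p; have [] := dx p.
- rewrite (_ : pd_t f = ft)//; apply/funext => p.
  by have [_] := dt p.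
- rewrite (_ : pd_x f = fx)//; apply/funext => p.
  by have [_] := dx p.
Qed.

Lemma is_Ck_pred (R : realType) (k : nat) (f : R * R -> R) :
  is_Ck k.+1 f -> is_Ck k f.
Proof.
elim: k f => [f []//|k IH f [cf [dt dx ct cx]]].
exact: (conj cf (And4 dt dx (IH _ ct) (IH _ cx))).
Qed.

Lemma is_Ck_cst (R : realType) (k : nat) (c : R) : is_Ck k (cst c : R * R -> R).
Proof.
elim: k c => [|k IH] c; first by split => // p; exact: cvg_cst.
apply: (@is_CkS_intro _ _ _ (cst 0) (cst 0)) => // p; first exact: cvg_cst.
Qed.

Lemma is_CkD (R : realType) (k : nat) (f g : R * R -> R) :
  is_Ck k f -> is_Ck k g -> is_Ck k (f \+ g).
Proof.
elim: k f g => [|k IH] f g.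
  by move=> [cf _] [cg _]; split => // p; exact: (cvgD (cf p) (cg p)).
move=> [cf [ft fx cft cfx]] [cg [gt gx cgt cgx]].
apply: (is_CkS_intro _ _ _ (IH _ _ cft cgt) (IH _ _ cfx cgx)).
- by move=> p; exact: (cvgD (cf p) (cg p)).
- by move=> p; apply: is_deriveD; exact: derivableP.
- by move=> p; apply: is_deriveD; exact: derivableP.
Qed.

Lemma is_CkM (R : realType) (k : nat) (f g : R * R -> R) :
  is_Ck k f -> is_Ck k g -> is_Ck k (f \* g).
Proof.
elim: k f g => [|k IH] f g.
  by move=> [cf _] [cg _]; split => // p; exact: (cvgM (cf p) (cg p)).
move=> hf hg; have [cf [ft fx cft cfx]] := hf; have [cg [gt gx cgt cgx]] := hg.
(* The product rule also involves the factors themselves, at level $k$ only. *)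
have hf' := is_Ck_pred hf; have hg' := is_Ck_pred hg.
apply: (is_CkS_intro _ _ _ (is_CkD (IH _ _ hf' cgt) (IH _ _ hg' cft))
  (is_CkD (IH _ _ hf' cgx) (IH _ _ hg' cfx))).
- by move=> p; exact: (cvgM (cf p) (cg p)).
- by move=> p; apply: is_deriveM; exact: derivableP.
- by move=> p; apply: is_deriveM; exact: derivableP.
Qed.

Lemma is_derive_inv (R : realType) (V : normedModType R) (f : V -> R)
    (p v : V) (df : R) : f p != 0 -> is_derive p v f df ->
  is_derive p v (fun q => (f q)^-1) (- (f p) ^- 2 * df).
Proof.
move=> f0 [h1 <-]; apply: DeriveDef; first exact: derivableV.
exact: deriveV.
Qed.

(** Since $(1/f)' = -(1/f)^2 f'$ is built from $1/f$ and $f'$, the class $C^k$ of $1/f$ gives the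
    class $C^{k+1}$. *)
Lemma is_CkV (R : realType) (k : nat) (f : R * R -> R) :
  (forall p, f p != 0) -> is_Ck k f -> is_Ck k (fun p => (f p)^-1).
Proof.
move=> f0; elim: k => [|k IH].
  by move=> [cf _]; split => // p; exact: (cvgV (f0 p) (cf p)).
move=> hf; have [cf [ft fx cft cfx]] := hf.
have hV := IH (is_Ck_pred hf).
have hV2 := is_CkM (is_Ck_cst k (- 1)) (is_CkM hV hV).
apply: (is_CkS_intro _ _ _ (is_CkM hV2 cft) (is_CkM hV2 cfx)).
- by move=> p; exact: (cvgV (f0 p) (cf p)).
- move=> p; have d := is_derive_inv (f0 p) (derivableP (ft p)); apply: (is_derive_eq d).
  by rewrite /= mulN1r expr2 invfM.
- move=> p; have d := is_derive_inv (f0 p) (derivableP (fx p)); apply: (is_derive_eq d).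
  by rewrite /= mulN1r expr2 invfM.
Qed.

Lemma continuous_affine (R : realType) (al be ga : R) :
  continuous (fun p : R * R => al * p.1 + be * p.2 + ga).
Proof.
move=> p; apply: cvgD; last exact: cvg_cst.
by apply: cvgD; (apply: cvgM; first exact: cvg_cst); [exact: cvg_fst|exact: cvg_snd].
Qed.

Lemma is_Ck_flat (R : realType) (k : nat) (P : {poly R}) (al be ga : R) :
  is_Ck k (fun p => flat P (al * p.1 + be * p.2 + ga)).
Proof.
have cont Q : continuous (fun p : R * R => flat Q (al * p.1 + be * p.2 + ga)).
  move=> p; apply: (@continuous_comp _ _ _ (fun p : R * R => al * p.1 + be * p.2 + ga)).
    exact: continuous_affine.
  exact: continuous_flat.
elim: k P => [|k IH] P; first by split => //; exact: cont.
have IH' := IH ('X ^+ 2 * (P - P^`())).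
apply: (is_CkS_intro _ _ _ (is_CkM (is_Ck_cst k al) IH') (is_CkM (is_Ck_cst k be) IH')).
- exact: cont.
- move=> p; have d := is_derive_comp_affine (1, 0) (is_derive_flat P (al * p.1 + be * p.2 + ga)).
  by move; apply: (is_derive_eq d); rewrite /= mulr1 mulr0 addr0.
- move=> p; have d := is_derive_comp_affine (0, 1) (is_derive_flat P (al * p.1 + be * p.2 + ga)).
  by move; apply: (is_derive_eq d); rewrite /= mulr1 mulr0 add0r.
Qed.

(** * Smooth steps and plateaus *)

Definition step (R : realType) (x : R) : R :=
  flat 1 x / (flat 1 x + flat 1 (1 - x)).

(** The quotient rule for [step]: [flat 1] is $e^{-1/x}$ on $x > 0$, and [flat ('X ^+ 2)] is its
    derivative. *)
Definition dstep (R : realType) (x : R) : R :=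
  (flat ('X ^+ 2) x * flat 1 (1 - x) + flat 1 x * flat ('X ^+ 2) (1 - x))
  / (flat 1 x + flat 1 (1 - x)) ^+ 2.

Lemma step_den_gt0 (R : realType) (x : R) : 0 < flat 1 x + flat 1 (1 - x).
Proof.
case: (ltP 0 x) => x0.
  by rewrite ltr_pwDl ?flat1_gt0 ?flat1_ge0.
by rewrite ltr_wpDl ?flat1_ge0// flat1_gt0//; lra.
Qed.

Lemma step_ge0 (R : realType) (x : R) : 0 <= step x.
Proof. by rewrite divr_ge0 ?flat1_ge0// ltW// step_den_gt0. Qed.

Lemma step_le1 (R : realType) (x : R) : step x <= 1.
Proof. by rewrite ler_pdivrMr ?step_den_gt0// mul1r lerDl flat1_ge0. Qed.

Lemma step_eq0 (R : realType) (x : R) : x <= 0 -> step x = 0.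
Proof. by move=> x0; rewrite /step flat_le0// mul0r. Qed.

Lemma step_eq1 (R : realType) (x : R) : 1 <= x -> step x = 1.
Proof.
move=> x1; have := step_den_gt0 x; rewrite /step (@flat_le0 _ _ (1 - x)) ?addr0.
  by move=> ?; rewrite divff// gt_eqF.
by lra.
Qed.

Lemma dstep_ge0 (R : realType) (x : R) : 0 <= dstep x.
Proof.
have flatX2_ge0 y : 0 <= flat ('X ^+ 2 : {poly R}) y.
  by rewrite /flat; case: ifP => // _; rewrite hornerXn mulr_ge0 ?expR_ge0 ?sqr_ge0.
by rewrite divr_ge0 ?sqr_ge0// addr_ge0// mulr_ge0// flat1_ge0.
Qed.

Lemma dstep_eq0 (R : realType) (x : R) : x <= 0 \/ 1 <= x -> dstep x = 0.
Proof.
move=> x01; rewrite /dstep; case: x01 => x01.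
  by rewrite !(flat_le0 _ x01) !mul0r addr0 mul0r.
have x1 : 1 - x <= 0 by lra.
by rewrite !(flat_le0 _ x1) !mulr0 addr0 mul0r.
Qed.

Lemma is_derive_step (R : realType) (x : R) : is_derive x 1 (@step R) (dstep x).
Proof.
have d1 (y : R) : is_derive y 1 (flat 1) (flat ('X ^+ 2) y).
  apply: is_derive_eq (is_derive_flat 1 y) _.
  by rewrite -[1 in X in X^`()]/(1%:P) derivC subr0 mulr1.
have d2 : is_derive x 1 (fun y : R => flat 1 (1 - y)) (- flat ('X ^+ 2) (1 - x)).
  have dm : is_derive x 1 (fun y : R => 1 - y) (- 1).
    by have := is_deriveB (is_derive_cst (1 : R) x (1 : R)) (is_derive_id x (1 : R)); rewrite sub0r.
  by rewrite -mulrN1; exact: (@is_derive1_comp _ (flat 1) (fun y : R => 1 - y)).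
have den : flat 1 x + flat 1 (1 - x) != 0 by rewrite gt_eqF// step_den_gt0.
have := is_deriveM (d1 x) 
  (@is_derive_inv _ _ (fun y : R => flat 1 y + flat 1 (1 - y)) _ _ _ den (is_deriveD (d1 x) d2)).
move=> d; apply: (is_derive_eq d).
by rewrite /GRing.scale/= /dstep /=; field.
Qed.

Lemma continuous_dstep (R : realType) : continuous (@dstep R).
Proof.
move=> x.
have c1 (P : {poly R}) : {for x, continuous (fun y : R => flat P (1 - y))}.
  apply: (@continuous_comp _ _ _ (fun y : R => 1 - y)); last exact: continuous_flat.
  by apply: cvgB; [exact: cvg_cst|exact: cvg_id].
have c2 (P : {poly R}) : {for x, continuous (flat P)} by exact: continuous_flat.
apply: cvgM.
  by apply: cvgD; apply: cvgM; [exact: c2|exact: c1|exact: c2|exact: c1].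
apply: cvgV; first by rewrite expf_neq0// gt_eqF// step_den_gt0.
by rewrite expr2; apply: cvgM; (apply: cvgD; [exact: c2|exact: c1]).
Qed.

Lemma dstep_bounded (R : realType) : exists C : R, forall x, dstep x <= C.
Proof.
have [c _ Hc] := @EVT_max R (@dstep R) 0 1 ler01
  (continuous_subspaceT (@continuous_dstep R)).
exists (dstep c) => x; case: (boolP (x \in `[0, 1])) => [/Hc//|].
rewrite in_itv/= negb_and -!ltNge => /orP x01; rewrite dstep_eq0 ?dstep_ge0//.
by case: x01 => /ltW; [left|right].
Qed.

Lemma is_Ck_step (R : realType) (k : nat) (al be ga : R) :
  is_Ck k (fun p => step (al * p.1 + be * p.2 + ga)).
Proof.
have h1 := @is_Ck_flat R k 1 al be ga.
have h2 := @is_Ck_flat R k 1 (- al) (- be) (1 - ga).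
have -> : (fun p : R * R => step (al * p.1 + be * p.2 + ga)) =
  (fun p => flat 1 (al * p.1 + be * p.2 + ga)) \*
  (fun p => (flat 1 (al * p.1 + be * p.2 + ga) +
     flat 1 (- al * p.1 + - be * p.2 + (1 - ga)))^-1).
  apply/funext => p /=; rewrite /step; congr (_ / (_ + flat _ _)); ring.
apply: is_CkM => //; apply: is_CkV; last exact: is_CkD.
move=> p; rewrite (_ : - al * p.1 + - be * p.2 + (1 - ga) =
  1 - (al * p.1 + be * p.2 + ga)); last by ring.
by rewrite gt_eqF// step_den_gt0.
Qed.

(** For $0 < 2k \le b - a$ this rises from 0 to 1 on $[a, a+k]$, equals 1 up to $b-k$, and falls
    back to 0 on $[b-k, b]$. *)
Definition plateau (R : realType) (a b k t : R) : R :=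
  step ((t - a) / k) * step ((b - t) / k).

Definition dplateau (R : realType) (a b k t : R) : R :=
  dstep ((t - a) / k) / k * step ((b - t) / k)
  - step ((t - a) / k) * (dstep ((b - t) / k) / k).

Lemma is_derive_plateau (R : realType) (a b k t : R) :
  is_derive t 1 (plateau a b k) (dplateau a b k t).
Proof.
have dl : is_derive t 1 (fun t : R => step ((t - a) / k)) (dstep ((t - a) / k) / k).
  have dm : is_derive t 1 (fun t : R => (t - a) / k) k^-1.
    have d := is_deriveM (is_deriveB (is_derive_id t (1 : R)) (is_derive_cst a t (1 : R)))
      (is_derive_cst k^-1 t (1 : R)).
    by apply: (is_derive_eq d); rewrite /GRing.scale/= mulr0 add0r subr0 mulr1.
  have ds := is_derive_step ((t - a) / k).
  exact: (@is_derive1_comp _ (@step R) (fun t : R => (t - a) / k)).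
have dr : is_derive t 1 (fun t : R => step ((b - t) / k)) (- (dstep ((b - t) / k) / k)).
  have dm : is_derive t 1 (fun t : R => (b - t) / k) (- k^-1).
    have d := is_deriveM (is_deriveB (is_derive_cst b t (1 : R)) (is_derive_id t (1 : R)))
      (is_derive_cst k^-1 t (1 : R)).
    by apply: (is_derive_eq d); rewrite /GRing.scale/= mulr0 add0r sub0r mulrN1.
  have ds := is_derive_step ((b - t) / k).
  by rewrite -mulrN; exact: (@is_derive1_comp _ (@step R) (fun t : R => (b - t) / k)).
apply: (is_derive_eq (is_deriveM dl dr)).
by rewrite /GRing.scale/= /dplateau; ring.
Qed.

Lemma continuous_step (R : realType) : continuous (@step R).
Proof.
move=> x; apply/differentiable_continuous/derivable1_diffP.
by have [] := is_derive_step x.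
Qed.

Lemma continuous_plateau (R : realType) (a b k : R) : continuous (plateau a b k).
Proof.
move=> x; apply/differentiable_continuous/derivable1_diffP.
by have [] := is_derive_plateau a b k x.
Qed.

Lemma continuous_dplateau (R : realType) (a b k : R) : continuous (dplateau a b k).
Proof.
move=> t.
have ca : (fun t : R => (t - a) / k) @ t --> (t - a) / k.
  by apply: cvgM; [apply: cvgB; [exact: cvg_id|exact: cvg_cst]|exact: cvg_cst].
have cb : (fun t : R => (b - t) / k) @ t --> (b - t) / k.
  by apply: cvgM; [apply: cvgB; [exact: cvg_cst|exact: cvg_id]|exact: cvg_cst].
have cs x : @step R y @[y --> x] --> step x by exact: continuous_step.
have cd x : @dstep R y @[y --> x] --> dstep x by exact: continuous_dstep.
by apply: cvgB; apply: cvgM; rewrite //;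
  do ?[exact: (cvg_comp _ _ ca (cs _))|exact: (cvg_comp _ _ cb (cs _))
    |apply: cvgM; [|exact: cvg_cst]
    |exact: (cvg_comp _ _ ca (cd _))|exact: (cvg_comp _ _ cb (cd _))].
Qed.

Section plateau_values.
Variables (R : realType) (a b k : R).
Hypothesis (k0 : 0 < k).

Lemma plateau_ge0 t : 0 <= plateau a b k t.
Proof. by rewrite mulr_ge0 ?step_ge0. Qed.

Lemma plateau_le1 t : plateau a b k t <= 1.
Proof. by rewrite mulr_ile1 ?step_ge0 ?step_le1. Qed.

Lemma plateau_eq0 t : t <= a \/ b <= t -> plateau a b k t = 0.
Proof.
move=> tab; rewrite /plateau; case: tab => tab.
  by rewrite (@step_eq0 _ ((t - a) / k)) ?mul0r// pmulr_lle0 ?invr_gt0// subr_le0.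
by rewrite (@step_eq0 _ ((b - t) / k)) ?mulr0// pmulr_lle0 ?invr_gt0// subr_le0.
Qed.

Lemma plateau_eq1 t : a + k <= t -> t <= b - k -> plateau a b k t = 1.
Proof.
by move=> ta tb; rewrite /plateau !step_eq1 ?mulr1// ler_pdivlMr// mul1r; lra.
Qed.

Lemma dplateau_eq0 t : t <= a \/ b <= t -> dplateau a b k t = 0.
Proof.
have le0 x : x <= 0 -> x / k <= 0 by move=> ?; rewrite pmulr_lle0 ?invr_gt0.
move=> tab; rewrite /dplateau; case: tab => tab.
  have h : (t - a) / k <= 0 by apply: le0; lra.
  by rewrite (dstep_eq0 (or_introl h)) (step_eq0 h) !mul0r subr0.
have h : (b - t) / k <= 0 by apply: le0; lra.
by rewrite (dstep_eq0 (or_introl h)) (step_eq0 h) mul0r !mulr0 subr0.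
Qed.

Lemma dplateau_left t : t <= b - k -> dplateau a b k t = dstep ((t - a) / k) / k.
Proof.
move=> tb; have h : 1 <= (b - t) / k by rewrite ler_pdivlMr// mul1r; lra.
by rewrite /dplateau (dstep_eq0 (or_intror h)) (step_eq1 h) mul0r mulr0 subr0 mulr1.
Qed.

Lemma dplateau_right t : a + k <= t -> dplateau a b k t = - (dstep ((b - t) / k) / k).
Proof.
move=> ta; have h : 1 <= (t - a) / k by rewrite ler_pdivlMr// mul1r; lra.
by rewrite /dplateau (dstep_eq0 (or_intror h)) (step_eq1 h) !mul0r sub0r mul1r.
Qed.

Lemma dplateau_ge0 t : t <= b - k -> 0 <= dplateau a b k t.
Proof. by move=> tb; rewrite dplateau_left// divr_ge0 ?dstep_ge0// ltW. Qed.

Lemma dplateau_le0 t : a + k <= t -> dplateau a b k t <= 0.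
Proof. by move=> tb; rewrite dplateau_right// oppr_le0 divr_ge0 ?dstep_ge0// ltW. Qed.

Lemma dplateau_flat t : a + k <= t -> t <= b - k -> dplateau a b k t = 0.
Proof.
by move=> ta tb; apply/eqP; rewrite eq_le dplateau_le0// dplateau_ge0.
Qed.

(** The bound grows like $1/k$. It serves only to prove integrability and does not enter any final
    estimate. *)
Lemma dplateau_bounded : exists C : R, forall t, `|dplateau a b k t| <= C.
Proof.
have [C HC] := dstep_bounded R; exists (C / k + C / k) => t.
have h x y : `|dstep x / k * step y| <= C / k.
  have d0 : 0 <= dstep x / k by rewrite divr_ge0 ?dstep_ge0// ltW.
  rewrite normrM (ger0_norm d0) (ger0_norm (step_ge0 y)) -[leRHS]mulr1.
  by apply: ler_pM; rewrite ?step_ge0 ?step_le1// ler_pM2r ?invr_gt0.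
apply: le_trans (ler_normB _ _) _; rewrite lerD ?h//.
by rewrite mulrC h.
Qed.

End plateau_values.

(* The cut-off in x moves with the line x = c t + d, which stands for a tangent to
   the curve: a cut-off in x - Phi t would only be C^1. *)
Definition window (R : realType) (a b k w c d : R) (p : R * R) : R :=
  plateau a b k p.1 * plateau (- (2 * w)) (2 * w) w (p.2 - c * p.1 - d).

Lemma window_pd (R : realType) (a b k w c d : R) (p v : R * R) :
  is_derive p v (window a b k w c d)
    (v.1 * (dplateau a b k p.1 * plateau (- (2 * w)) (2 * w) w (p.2 - c * p.1 - d))
     + (v.2 - c * v.1) *
       (plateau a b k p.1 * dplateau (- (2 * w)) (2 * w) w (p.2 - c * p.1 - d))).
Proof.
have h1 := @is_derive_comp_affine R (plateau a b k) _ 1 0 0 p v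
  (is_derive_plateau a b k _).
have h2 := @is_derive_comp_affine R (plateau (- (2 * w)) (2 * w) w) _ (- c) 1 (- d) p v
  (is_derive_plateau _ _ _ _).
have -> : window a b k w c d =
    (fun q : R * R => plateau a b k (1 * q.1 + 0 * q.2 + 0)) *
    (fun q : R * R => plateau (- (2 * w)) (2 * w) w (- c * q.1 + 1 * q.2 - d)).
  apply/funext => q; rewrite /window.
  by congr (plateau _ _ _ _ * plateau _ _ _ _); ring.
have d12 := is_deriveM h1 h2; apply: (is_derive_eq d12).
rewrite /GRing.scale/= !mul1r mul0r !addr0.
have -> : - c * p.1 + p.2 - d = p.2 - c * p.1 - d by ring.
ring.
Qed.

Lemma pd_t_window (R : realType) (a b k w c d : R) (p : R * R) :
  pd_t (window a b k w c d) p =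
  dplateau a b k p.1 * plateau (- (2 * w)) (2 * w) w (p.2 - c * p.1 - d)
  - c * (plateau a b k p.1 * dplateau (- (2 * w)) (2 * w) w (p.2 - c * p.1 - d)).
Proof.
rewrite /pd_t; have [_ ->] := window_pd a b k w c d p (1, 0).
by rewrite /= mul1r mulr1 sub0r mulNr.
Qed.

Lemma pd_x_window (R : realType) (a b k w c d : R) (p : R * R) :
  pd_x (window a b k w c d) p =
  plateau a b k p.1 * dplateau (- (2 * w)) (2 * w) w (p.2 - c * p.1 - d).
Proof.
rewrite /pd_x; have [_ ->] := window_pd a b k w c d p (0, 1).
by rewrite /= mul0r add0r mulr0 subr0 mul1r.
Qed.

Lemma compact_closure_bounded (R : realType) (A : set (R * R)) (a b u v : R) :
  (forall p, A p -> [/\ a <= p.1, p.1 <= b, u <= p.2 & p.2 <= v]) ->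
  compact (closure A).
Proof.
move=> HA; have hc : compact (`[a, b]%classic `*` `[u, v]%classic : set (R * R)).
  by apply: compact_setX; exact: segment_compact.
apply: (subclosed_compact _ hc); first exact: closed_closure.
rewrite closureE; apply: smallest_sub.
  by apply: compact_closed hc; exact: norm_hausdorff.
by move=> p /HA[h1 h2 h3 h4]; split; rewrite /= in_itv/=; apply/andP.
Qed.

Lemma affine_bound (R : realDomainType) (a b c d t : R) : a <= t -> t <= b ->
  `|c * t + d| <= `|c| * (`|a| + `|b|) + `|d|.
Proof.
move=> ta tb; apply: le_trans (ler_normD _ _) _; rewrite lerD2r normrM ler_wpM2l//.
rewrite ler_norml; have := ler_norm (- a); rewrite normrN.
have := ler_norm b; have := normr_ge0 a; have := normr_ge0 b.
by move=> *; apply/andP; split; lra.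
Qed.

Lemma test_function_window (R : realType) (a b k w c d : R) :
  0 < k -> 0 < w -> test_function (window a b k w c d).
Proof.
move=> k0 w0; split.
  (* Each plateau is a product of two steps with affine arguments, so the window is a product of
     four functions covered by [is_Ck_step]. *)
  move=> n; have -> : window a b k w c d =
    ((fun p => step (k^-1 * p.1 + 0 * p.2 + (- a / k))) \*
     (fun p => step (- k^-1 * p.1 + 0 * p.2 + b / k))) \*
    ((fun p => step (- c / w * p.1 + w^-1 * p.2 + (2 * w - d) / w)) \*
     (fun p => step (c / w * p.1 + - w^-1 * p.2 + (2 * w + d) / w))).
    apply/funext => p; rewrite /window /plateau /=.
    by congr (step _ * step _ * (step _ * step _)); ring.
  by apply: is_CkM; apply: is_CkM; exact: is_Ck_step.
(* Where the window is nonzero, $a < t < b$ and $|x - ct - d| < 2w$, hence $|x| \le N$. *)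
pose N := 2 * w + `|c| * (`|a| + `|b|) + `|d|.
apply: (@compact_closure_bounded _ _ a b (- N) N) => -[t x] /=.
rewrite /window mulf_eq0 negb_or /= => /andP[h1 h2].
have [ta tb] : a < t /\ t < b.
  by split; rewrite ltNge; apply/negP => h; move/negP: h1; apply;
    rewrite plateau_eq0//; [left|right].
have [xa xb] : - (2 * w) < x - c * t - d /\ x - c * t - d < 2 * w.
  by split; rewrite ltNge; apply/negP => h; move/negP: h2; apply;
    rewrite plateau_eq0//; [left|right].
have := affine_bound c d (ltW ta) (ltW tb); rewrite ler_norml => /andP[? ?].
by split; rewrite /N; lra.
Qed.

(** * Integrals over open intervals *)

Section integral_open_interval.
Variable R : realType.
Notation mu := (@lebesgue_measure R).
Implicit Types (f h X : R -> R) (a b u v s x A B K : R).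

(** Cutting [D] at [s] leaves two open sets, on which continuity gives measurability, and at most
    one point. In the application [s] is where a slice at fixed time meets the curve. *)
Lemma continuous_off_measurable f s (D : set R) : measurable D ->
  (forall x, D x -> x != s -> {for x, continuous f}) ->
  open D -> measurable_fun D f.
Proof.
move=> mD cf oD; have -> : D = (D `&` `]-oo, s[) `|` (D `&` `]s, +oo[) `|` (D `&` [set s]).
  rewrite -!setIUr; apply/seteqP; split => [x Dx|x []//]; split => //=.
  by rewrite !in_itv/= andbT; case: ltgtP => [||->]; [left; left|left; right|right].
have oc i : open ([set` i] : set R) -> s \notin i -> measurable_fun (D `&` [set` i]) f.
  move=> oi si; apply: open_continuous_measurable_fun; first exact: openI.
  move=> x; rewrite inE => -[Dx ix]; apply: cf => //.
  by apply: contraNneq si => <-.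
apply/measurable_funU; first by apply: measurableU; exact: measurableI.
  by apply: measurableI => //; exact: measurable_set1.
split.
  apply/measurable_funU; [exact: measurableI|exact: measurableI|split].
  - by apply: oc; [exact: interval_open|rewrite in_itv/= ltxx].
  - by apply: oc; [exact: interval_open|rewrite in_itv/= ltxx].
apply: (@measurable_funS _ _ _ _ [set s]); [exact: measurable_set1|by move=> x []|].
exact: measurable_fun_set1.
Qed.

Lemma integrable_bounded_oo f a b K :
  measurable_fun `]a, b[ f -> (forall x, a < x < b -> `|f x| <= K) ->
  mu.-integrable `]a, b[ (EFin \o f).
Proof.
move=> mf fK; apply: measurable_bounded_integrable => //.
  by rewrite /= lebesgue_measure_itv/=; case: ifP => // _; rewrite -EFinB ltry.
exists K; split; rewrite ?num_real// => M KM x/=; rewrite in_itv/= => xab.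
by apply: le_trans (fK _ xab) _; exact: ltW.
Qed.

Lemma integrable_bounded_off_oo f a b s K :
  measurable_fun `]a, b[ f -> (forall x, a < x < b -> x != s -> `|f x| <= K) ->
  mu.-integrable `]a, b[ (EFin \o f).
Proof.
(* The value at [s] is uncontrolled, so it is included in the constant. *)
move=> mf fK; apply: (@integrable_bounded_oo _ _ _ (Num.max K `|f s|)) => // x xab.
rewrite le_max; have [->|/fK -> //] := eqVneq x s; first by rewrite lexx orbT.
Qed.

Lemma continuous_integrable_oo f a b : continuous f ->
  mu.-integrable `]a, b[ (EFin \o f).
Proof.
move=> cf; have : mu.-integrable `[a, b] (EFin \o f).
  apply: continuous_compact_integrable; first exact: segment_compact.
  exact: continuous_subspaceT.
by apply: integrableS => //; exact: subset_itv_oo_cc.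
Qed.

Lemma Rintegral_FTC_oo X X' u v : u <= v -> continuous X' ->
  (forall x, is_derive x 1 X (X' x)) ->
  \int[mu]_(x in `]u, v[) X' x = X v - X u.
Proof.
rewrite le_eqVlt => /predU1P[->|uv] cX' dX.
  by rewrite set_itvoo0 Rintegral_set0 subrr.
have cX : continuous X.
  move=> x; apply/differentiable_continuous/derivable1_diffP.
  by have [] := dX x.
rewrite /Rintegral -(@integral_itv_bndoo _ _ _ _ true false); last first.
  apply/measurable_EFinP; apply: (@measurable_funS _ _ _ _ setT) => //.
  exact: continuous_measurable_fun.
rewrite (@continuous_FTC2 _ X' X) //=.
- exact: continuous_subspaceT.
- split; first by move=> x _; have [] := dX x.
    by apply: cvg_at_right_filter; exact: cX.
  by apply: cvg_at_left_filter; exact: cX.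
- by move=> x _; rewrite derive1E; have [_ ->] := dX x.
Qed.

(* Weighing the error by X' itself keeps bounds on the derivatives of the cut-offs, which
   blow up as the ramps get steeper, out of the estimates. *)
Lemma Rintegral_near_derivative h X X' A B K u v : u <= v ->
  continuous X' -> (forall x, is_derive x 1 X (X' x)) ->
  mu.-integrable `]u, v[ (EFin \o h) ->
  (forall x, u < x < v -> `|h x - A * X' x| <= B + K * X' x) ->
  `|\int[mu]_(x in `]u, v[) h x - A * (X v - X u)| <= B * (v - u) + K * (X v - X u).
Proof.
move=> uv cX' dX ih hb.
have iX' := @continuous_integrable_oo X' u v cX'.
have iAX' : mu.-integrable `]u, v[ (EFin \o (fun x => A * X' x)).
  by apply: continuous_integrable_oo => x; apply: cvgM; [exact: cvg_cst|exact: cX'].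
have iKX' : mu.-integrable `]u, v[ (EFin \o (fun x => K * X' x)).
  by apply: continuous_integrable_oo => x; apply: cvgM; [exact: cvg_cst|exact: cX'].
have iB : mu.-integrable `]u, v[ (EFin \o (fun=> B)).
  by apply: continuous_integrable_oo => x; exact: cvg_cst.
have iBK : mu.-integrable `]u, v[ (EFin \o (fun x => B + K * X' x)).
  apply: continuous_integrable_oo => x; apply: cvgD; first exact: cvg_cst.
  by apply: cvgM; [exact: cvg_cst|exact: cX'].
have ihA : mu.-integrable `]u, v[ (EFin \o (fun x => h x - A * X' x)).
  rewrite (_ : _ \o _ = ((EFin \o h) \- (EFin \o (fun x => (A * X' x)%R)))%E)//.
  exact: integrableB.
rewrite -(Rintegral_FTC_oo uv cX' dX) -!RintegralZl// -RintegralB//.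
apply: (le_trans (le_normr_Rintegral _ ihA)); first by [].
have -> : B * (v - u) = \int[mu]_(x in `]u, v[) B.
  rewrite Rintegral_cst//= lebesgue_measure_itv/= lte_fin.
  by case: ltP uv => // vu uv; have -> : v = u by [apply/le_anti/andP]; rewrite subrr.
rewrite -RintegralD//; apply: le_Rintegral => //.
exact: integrable_norm ihA.
Qed.

Lemma Rintegral_split_oo f a s b : a <= s -> s <= b ->
  mu.-integrable `]a, b[ (EFin \o f) ->
  \int[mu]_(x in `]a, b[) f x =
  \int[mu]_(x in `]a, s[) f x + \int[mu]_(x in `]s, b[) f x.
Proof.
rewrite le_eqVlt => /predU1P[->|as_] sb intf.
  by rewrite set_itvoo0 Rintegral_set0 add0r.
move: sb; rewrite le_eqVlt => /predU1P[<-|sb].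
  by rewrite set_itvoo0 Rintegral_set0 addr0.
have as1 : (BRight a <= BRight s)%O by rewrite bnd_simp ltW.
have sb1 : (BRight s <= BLeft b)%O by rewrite bnd_simp.
have <- := Rintegral_itvB intf as1 sb1.
have intf1 : mu.-integrable `]a, s[ (EFin \o f).
  apply: integrableS intf => // x /=; rewrite !in_itv/= => /andP[-> /=] xs.
  exact: lt_trans xs sb.
have -> := Rintegral_itv_bndo_bndc intf1.
by rewrite [RHS]addrC subrK.
Qed.

(** Both sides are integrals over the whole line of the same function extended by zero. This cuts
    integrals over unbounded domains down to where the test function lives. *)
Lemma Rintegral_support (A B : set R) f : (A `<=` B)%classic ->
  (forall x, B x -> ~ A x -> f x = 0) ->
  \int[mu]_(x in B) f x = \int[mu]_(x in A) f x.
Proof.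
move=> AB f0; rewrite [LHS]Rintegral_mkcond [RHS]Rintegral_mkcond.
apply: eq_Rintegral => x _; rewrite !patchE.
case: ifPn => xB; case: ifPn => xA //.
- by rewrite f0//; [exact: set_mem|move/mem_set; exact/negP].
- by move: xB; rewrite notin_setE => nB; exfalso; apply: nB; apply: AB; exact: set_mem.
Qed.

End integral_open_interval.

(** * Slices at fixed time *)

Section slice_integral.
Variables (R : realType) (f : R * R -> R) (Phi : R -> R) (a b u v K : R).
Notation mu := (@lebesgue_measure R).
Hypothesis f_cont : forall t x, a < t < b -> x != Phi t -> {for (t, x), continuous f}.
Hypothesis f_bnd : forall t x, a < t < b -> u < x < v -> x != Phi t -> `|f (t, x)| <= K.

Lemma slice_measurable t (D : set R) : a < t < b -> measurable D -> open D ->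
  measurable_fun D (fun x => f (t, x)).
Proof.
move=> tab mD oD; apply: (continuous_off_measurable (s := Phi t)) => // x _ xP.
apply: (@continuous_comp _ _ _ (fun x : R => (t, x)) f); last exact: f_cont.
by apply: (@cvg_pair _ _ _ _ (nbhs (t : R)) (nbhs (x : R))); [exact: cvg_cst|exact: cvg_id].
Qed.

Lemma slice_integrable t : a < t < b ->
  mu.-integrable `]u, v[ (EFin \o (fun x => f (t, x))).
Proof.
move=> tab; apply: (@integrable_bounded_off_oo _ _ _ _ (Phi t) K).
  by apply: slice_measurable => //; exact: interval_open.
by move=> x xuv xP; exact: f_bnd.
Qed.

(** Dominated convergence along sequences: the slices converge at every $x \ne \Phi(t)$, and each is
    bounded by [K] off a single point, so the exceptional sets are null. *)
Lemma slice_integral_continuous t : a < t < b ->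
  {for t, continuous (fun t => \int[mu]_(x in `]u, v[) f (t, x))}.
Proof.
move=> tab; apply/(@cvg_nbhsP _ R^o) => w wt.
have tz : nbhs t [set z | a < z < b].
  have := @near_in_itvoo R a b t; rewrite in_itv/= => /(_ tab).
  by apply: filterS => z; rewrite in_itv.
(* Dropping the first [N] terms keeps the whole sequence inside $]a, b[$, where the hypotheses
   apply. *)
have [N _ Nw] := wt _ tz.
have {}Nw n : a < w (n + N)%N < b by apply: Nw => /=; exact: leq_addl.
rewrite -(cvg_shiftn N); apply: fine_cvg; rewrite fineK; last first.
  exact: integrable_fin_num (slice_integrable tab).
have oD : open (`]u, v[%classic : set R) by exact: interval_open.
have DC := @dominated_convergence _ _ _ mu `]u, v[%classic (measurable_itv _)
  (fun n x => (f (w (n + N)%N, x))%:E) (EFin \o (fun x => f (t, x))) (fun=> K%:E).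
case: DC.
- by move=> n; apply/measurable_EFinP; exact: slice_measurable.
- by apply/measurable_EFinP; exact: slice_measurable.
- exists [set Phi t]; split; [exact: measurable_set1|exact: lebesgue_measure_set1|].
  move=> x /= /not_implyP[xuv nc]; apply: contrapT => /eqP xP; apply: nc.
  apply: cvg_EFin; first exact: nearW.
  apply: (@cvg_comp _ _ _ (fun n => (w (n + N)%N, x)) f _ (nbhs (t, x))); last exact: f_cont.
  apply: (@cvg_pair _ _ _ _ (nbhs (t : R)) (nbhs (x : R))).
    by rewrite (cvg_shiftn N).
  exact: cvg_cst.
- apply: integrable_bounded_oo; last by move=> x _; exact: lexx.
  exact: measurable_cst.
- apply: ae_foralln => n; exists [set Phi (w (n + N)%N)]; split.
  + exact: measurable_set1.
  + exact: lebesgue_measure_set1.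
  + move=> x /= /not_implyP[xuv nc]; apply: contrapT => /eqP xP; apply: nc.
    by rewrite lee_fin; apply: f_bnd => //; move: xuv; rewrite /= in_itv.
- by move=> _ _.
Qed.

End slice_integral.

(** * Plateaus with shrinking ramps *)

Section plateau_limit.
Variable R : realType.
Notation mu := (@lebesgue_measure R).
Implicit Types (g : R -> R) (a b k t : R).

Lemma continuous_on_integrable_oo g a b :
  (forall t, a <= t <= b -> {for t, continuous g}) ->
  mu.-integrable `]a, b[ (EFin \o g).
Proof.
move=> cg; have : mu.-integrable `[a, b] (EFin \o g).
  apply: continuous_compact_integrable; first exact: segment_compact.
  apply: continuous_in_subspaceT => t; rewrite inE/= in_itv/=; exact: cg.
by apply: integrableS => //; exact: subset_itv_oo_cc.
Qed.

(** With $\psi$ the plateau, the integrand is $(t\psi)'$, and $\psi$ vanishes at both ends. *)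
Lemma Rintegral_plateau_parts a b k : 0 < k -> a <= b ->
  \int[mu]_(t in `]a, b[) (t * dplateau a b k t + plateau a b k t) = 0.
Proof.
move=> k0 ab.
have cX : continuous (fun t => t * dplateau a b k t + plateau a b k t).
  move=> t; apply: cvgD; last exact: continuous_plateau.
  by apply: cvgM; [exact: cvg_id|exact: continuous_dplateau].
have dX t : is_derive t (1 : R) (fun t => t * plateau a b k t)
    (t * dplateau a b k t + plateau a b k t).
  have d := is_deriveM (is_derive_id t (1 : R)) (is_derive_plateau a b k t).
  by apply: (is_derive_eq d); rewrite /GRing.scale/= mulr1.
have -> := Rintegral_FTC_oo ab cX dX.
rewrite (@plateau_eq0 _ a b k k0 b); last by right.
by rewrite (@plateau_eq0 _ a b k k0 a) ?mulr0 ?subrr//; left.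
Qed.

(** The derivative of the plateau has mass 1 on the ramp at [a] and mass $-1$ on the ramp at [b].
    Since $2k \le b - a$, the midpoint separates the ramps, and each half costs at most [eta]. *)
Lemma Rintegral_dplateau_near g a b k eta : 0 < k -> 2 * k <= b - a -> a < b ->
  (forall t, a <= t <= b -> {for t, continuous g}) ->
  (forall t, a < t < a + k -> `|g t - g a| <= eta) ->
  (forall t, b - k < t < b -> `|g t - g b| <= eta) ->
  `|\int[mu]_(t in `]a, b[) (g t * dplateau a b k t) - (g a - g b)| <= 2 * eta.
Proof.
move=> k0 kab ab cg ga gb.
have eta0 : 0 <= eta by apply: le_trans (ga (a + k / 2) _) => //; apply/andP; split; lra.
have cgd t : a <= t <= b -> {for t, continuous (fun t => g t * dplateau a b k t)}.
  by move=> tab; apply: cvgM; [exact: cg|exact: continuous_dplateau].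
pose m := (a + b) / 2.
have [am mb] : a <= m /\ m <= b by split; rewrite /m; lra.
have [akm mbk] : a + k <= m /\ m <= b - k by split; rewrite /m; lra.
rewrite (Rintegral_split_oo am mb (continuous_on_integrable_oo cgd)).
have hl : `|\int[mu]_(t in `]a, m[) (g t * dplateau a b k t)
    - g a * (plateau a b k m - plateau a b k a)|
    <= 0 * (m - a) + eta * (plateau a b k m - plateau a b k a).
  apply: (Rintegral_near_derivative am (@continuous_dplateau _ a b k)
    (is_derive_plateau a b k)).
  - apply: continuous_on_integrable_oo => t /andP[ta tm]; apply: cgd.
    by rewrite ta (le_trans tm mb).
  - move=> t /andP[ta tm]; rewrite -mulrBl normrM add0r.
    have [tak|akt] := ltP t (a + k).
      rewrite (ger0_norm (dplateau_ge0 _ _ _)) ?ler_wpM2r ?dplateau_ge0 ?ga ?ta//;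
      by move: mbk; lra.
    by rewrite dplateau_flat// ?normr0 ?mulr0//; move: mbk; lra.
have hr : `|\int[mu]_(t in `]m, b[) (g t * dplateau a b k t)
    - (- g b) * (- plateau a b k b - - plateau a b k m)|
    <= 0 * (b - m) + eta * (- plateau a b k b - - plateau a b k m).
  (* The derivative is nonpositive on this half, so its opposite serves as the weight. *)
  have cN : continuous (fun t => - dplateau a b k t).
    by move=> t; apply: cvgN; exact: continuous_dplateau.
  have dN t : is_derive t (1 : R) (fun t => - plateau a b k t) (- dplateau a b k t).
    by apply: is_deriveN; exact: is_derive_plateau.
  apply: (Rintegral_near_derivative mb cN dN).
  - apply: continuous_on_integrable_oo => t /andP[mt tb]; apply: cgd.
    by rewrite tb (le_trans am mt).
  - move=> t /andP[mt tb]; rewrite mulrNN -mulrBl normrM add0r.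
    have [bkt|tbk] := ltP (b - k) t.
      rewrite (ler0_norm (dplateau_le0 _ _ _)) ?ler_wpM2r ?oppr_ge0 ?dplateau_le0 ?gb ?bkt//;
      by move: akm; lra.
    by rewrite dplateau_flat// ?oppr0 ?normr0 ?mulr0//; move: akm; lra.
have pm : plateau a b k m = 1 by rewrite plateau_eq1.
have pa : plateau a b k a = 0 by apply: plateau_eq0 => //; left.
have pb : plateau a b k b = 0 by apply: plateau_eq0 => //; right.
move: hl hr; rewrite pm pa pb subr0 oppr0 sub0r opprK !mulr1 !mul0r !add0r opprK.
set I1 := \int[mu]_(t in _) _; set I2 := \int[mu]_(t in _) _ => hl hr.
rewrite (_ : I1 + I2 - (g a - g b) = (I1 - g a) + (I2 + g b)); last by ring.
apply: le_trans (ler_normD _ _) _; lra.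
Qed.

(** The bound [K] does not depend on the ramp width. As $k \to 0$ the integral tends to $g(a) - g(b)
    + F(b-a)$, which inherits the bound. *)
Lemma plateau_limit g (F K a b : R) : a < b ->
  (forall t, a <= t <= b -> {for t, continuous g}) ->
  (forall k, 0 < k -> 2 * k <= b - a ->
    `|\int[mu]_(t in `]a, b[) (g t * dplateau a b k t + F * plateau a b k t)| <= K) ->
  `|g b - g a - F * (b - a)| <= K.
Proof.
move=> ab cg HK; apply/ler_addgt0Pr => e e0.
(* F psi integrates to - F t psi', so only psi' is left to concentrate at a and b. *)
pose g2 t := g t - F * t.
have cg2 t : a <= t <= b -> {for t, continuous g2}.
  by move=> tab; apply: cvgB; [exact: cg|apply: cvgM; [exact: cvg_cst|exact: cvg_id]].
have e20 : 0 < e / 2 by lra.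
have near_eta c : a <= c <= b ->
    exists2 r, 0 < r & forall t, `|c - t| < r -> `|g2 t - g2 c| <= e / 2.
  move=> /cg2 /cvgrPdistC_le /(_ _ e20) [r /= r0 Hr].
  by exists r => // t ct; exact: Hr.
have [|ra ra0 Hra] := near_eta a; first by rewrite lexx ltW.
have [|rb rb0 Hrb] := near_eta b; first by rewrite lexx ltW.
(* The ramps must be disjoint and lie within the radii on which [g2] is close to its values at [a]
   and [b]. *)
pose k := Num.min ((b - a) / 2) (Num.min ra rb).
have k0 : 0 < k by rewrite !lt_min ra0 rb0 !andbT; lra.
have kab : k <= (b - a) / 2 by rewrite ge_min lexx.
have kra : k <= ra by rewrite !ge_min lexx orbT.
have krb : k <= rb by rewrite !ge_min lexx !orbT.
have kab2 : 2 * k <= b - a by lra.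
have := Rintegral_dplateau_near k0 kab2 ab cg2.
move=> /(_ (e / 2)) H2.
have {}H2 : `|\int[mu]_(t in `]a, b[) (g2 t * dplateau a b k t) - (g2 a - g2 b)| <= 2 * (e / 2).
  apply: H2 => t /andP[t1 t2]; [apply: Hra|apply: Hrb].
    by rewrite distrC ger0_norm; lra.
  by rewrite ger0_norm; lra.
have := HK k k0 kab2.
have -> : \int[mu]_(t in `]a, b[) (g t * dplateau a b k t + F * plateau a b k t) =
    \int[mu]_(t in `]a, b[) (g2 t * dplateau a b k t).
  rewrite -[RHS]addr0 -(mulr0 F) -(Rintegral_plateau_parts k0 (ltW ab)).
  have c1 : continuous (fun t => t * dplateau a b k t + plateau a b k t).
    move=> t; apply: cvgD; last exact: continuous_plateau.
    by apply: cvgM; [exact: cvg_id|exact: continuous_dplateau].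
  rewrite -RintegralZl//; last exact: continuous_integrable_oo.
  rewrite -RintegralD//.
  - by apply: eq_Rintegral => t _; rewrite /g2; ring.
  - apply: continuous_on_integrable_oo => t tab.
    by apply: cvgM; [exact: cg2|exact: continuous_dplateau].
  - apply: continuous_integrable_oo => t.
    by apply: cvgM; [exact: cvg_cst|exact: c1].
set I := \int[mu]_(t in _) _ in H2 *; move=> HI.
rewrite (_ : g b - g a - F * (b - a) = (I - (g2 a - g2 b)) - I); last first.
  by rewrite /g2; ring.
apply: le_trans (ler_normB _ _) _; lra.
Qed.

End plateau_limit.

(** * Increments of the singular amplitude *)

Section weak_increment.
Variables (R : realType) (Phi : R -> R) (P Q : R * R -> R) (g : R -> R).
(** During $]a, b[$ the curve stays within [w] of the line $x = ct + d$. In the strip of half-width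
    $2w$ around that line, [M] bounds $P$, while [Al] and [Ar] approximate $Q - cP$ to the left and
    right of the curve with error [kap]. *)
Variables (a b w c d Al Ar M kap : R).
Notation mu := (@lebesgue_measure R).
Hypotheses (a0 : 0 < a) (ab : a < b) (w0 : 0 < w).
Hypothesis Pcont :
  forall t x, a < t < b -> x != Phi t -> {for (t, x), continuous P}.
Hypothesis Qcont :
  forall t x, a < t < b -> x != Phi t -> {for (t, x), continuous Q}.
Hypothesis near_line : forall t, a < t < b -> `|Phi t - c * t - d| <= w.
Hypothesis P_bnd : forall t x, a < t < b -> `|x - c * t - d| < 2 * w ->
  x != Phi t -> `|P (t, x)| <= M.
Hypothesis Q_left : forall t x, a < t < b -> `|x - c * t - d| < 2 * w ->
  x < Phi t -> `|Q (t, x) - c * P (t, x) - Al| <= kap.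
Hypothesis Q_right : forall t x, a < t < b -> `|x - c * t - d| < 2 * w ->
  Phi t < x -> `|Q (t, x) - c * P (t, x) - Ar| <= kap.
Hypothesis g_cont : forall t, a <= t <= b -> {for t, continuous g}.
Hypothesis weak : forall phi : R * R -> R, test_function phi ->
  (forall x, phi (0, x) = 0) ->
  half_plane_integral (fun p => P p * pd_t phi p + Q p * pd_x phi p)
  + \int[mu]_(t in `[0, +oo[) (g t * delta_derivative Phi phi t) = 0.

Section fixed_ramp.
Variable k : R.
Hypotheses (k0 : 0 < k) (kab : 2 * k <= b - a).

Let psi := plateau a b k.
Let dpsi := dplateau a b k.
Let chi := plateau (- (2 * w)) (2 * w) w.
Let dchi := dplateau (- (2 * w)) (2 * w) w.
Let phi := window a b k w c d.
Let D p := P p * pd_t phi p + Q p * pd_x phi p.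
Let z t x := x - c * t - d.

(** The terms are grouped by the derivative of each cut-off. As the window moves with speed [c], the
    factor of $\chi'$ is the flux $Q - cP$ relative to the moving line. *)
Let DE t x : D (t, x) = P (t, x) * (dpsi t * chi (z t x)) +
  (Q (t, x) - c * P (t, x)) * (psi t * dchi (z t x)).
Proof. by rewrite /D /phi pd_t_window pd_x_window /dpsi /psi /chi /dchi /z /=; ring. Qed.

Let D_out t x : ~ (a < t < b) -> D (t, x) = 0.
Proof.
move=> tab; have h : t <= a \/ b <= t.
  have [ta|at_] := leP t a; first by left.
  by right; rewrite leNgt; apply/negP => tb; apply: tab; rewrite at_.
by rewrite DE /dpsi /psi dplateau_eq0// plateau_eq0// !mul0r !mulr0 addr0.
Qed.

Let D_far t x : ~ (c * t + d - 2 * w < x < c * t + d + 2 * w) -> D (t, x) = 0.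
Proof.
move=> xz; have h : z t x <= - (2 * w) \/ 2 * w <= z t x.
  rewrite /z; have [|h1] := leP x (c * t + d - 2 * w); first by left; lra.
  have [h2|] := ltP x (c * t + d + 2 * w); first by exfalso; apply: xz; rewrite h1.
  by right; lra.
by rewrite DE /chi /dchi dplateau_eq0// plateau_eq0// !mulr0 addr0.
Qed.

Let G t := \int[mu]_(x in [set: R]) D (t, x).

Let G_out t : ~ (a < t < b) -> G t = 0.
Proof.
move=> tab; rewrite /G -[RHS](@Rintegral_set0 _ _ _ mu (fun x => D (t, x))).
by apply: Rintegral_support => // x _ _; exact: D_out.
Qed.

Let G_near t : G t = \int[mu]_(x in `]c * t + d - 2 * w, c * t + d + 2 * w[) D (t, x).
Proof.
by apply: Rintegral_support => // x _ /= xz; apply: D_far; move: xz; rewrite in_itv.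
Qed.

Let N := `|c| * (`|a| + `|b|) + `|d| + 2 * w.

(** The interval is independent of $t$, as the continuity of slice integrals in $t$ requires. *)
Let G_fixed t : a < t < b -> G t = \int[mu]_(x in `](- N), N[) D (t, x).
Proof.
move=> /andP[at_ tb]; apply: Rintegral_support => // x _ /= xN; apply: D_far => /andP[x1 x2].
apply: xN; rewrite in_itv/=.
have := affine_bound c d (ltW at_) (ltW tb); rewrite ler_norml => /andP[? ?].
by rewrite /N; apply/andP; split; lra.
Qed.

Let psi_ge0 t : 0 <= psi t. Proof. exact: plateau_ge0. Qed.
Let psi_le1 t : psi t <= 1. Proof. exact: plateau_le1. Qed.

Let D_cont t x : a < t < b -> x != Phi t -> {for (t, x), continuous D}.
Proof.
move=> tab xP; have [smooth _] := test_function_window a b c d k0 w0.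
have [_ [_ _ [c1 _] [c2 _]]] := smooth 1%N.
by apply: cvgD; apply: cvgM; [exact: Pcont|exact: c1
  |exact: Qcont|exact: c2].
Qed.

(** The bound on the left needs a witness: at mid-time the point at distance $w/2$ to the left of
    the curve is within $3w/2 < 2w$ of the line. *)
Let kap_ge0 : 0 <= kap.
Proof.
have ab' := ab; have w0' := w0; have mab : a < (a + b) / 2 < b by apply/andP; split; lra.
apply: le_trans (Q_left (x := Phi ((a + b) / 2) - w / 2) mab _ _) => //; last by lra.
by have := near_line mab; rewrite ler_norml ltr_norml => /andP[? ?]; apply/andP; split; lra.
Qed.

Let M_ge0 : 0 <= M.
Proof.
have ab' := ab; have w0' := w0; have mab : a < (a + b) / 2 < b by apply/andP; split; lra.
apply: le_trans (P_bnd (x := Phi ((a + b) / 2) - w / 2) mab _ _) => //; last by lra.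
by have := near_line mab; rewrite ler_norml ltr_norml => /andP[? ?]; apply/andP; split; lra.
Qed.

Let D_bounded : exists K : R, forall t x, a < t < b -> x != Phi t -> `|D (t, x)| <= K.
Proof.
have [C1 HC1] := dplateau_bounded a b k0.
have [C2 HC2] := dplateau_bounded (- (2 * w)) (2 * w) w0.
have w0' := w0; exists (M * (C1 * 1) + (kap + `|Al| + `|Ar|) * (1 * C2)) => t x tab xP.
have C10 : 0 <= C1 by exact: le_trans (HC1 0).
have C20 : 0 <= C2 by exact: le_trans (HC2 0).
have K0 : 0 <= kap + `|Al| + `|Ar| by rewrite !addr_ge0.
have [xz|xz] := boolP (c * t + d - 2 * w < x < c * t + d + 2 * w); last first.
  by rewrite D_far ?normr0 ?addr_ge0 ?mulr_ge0//; exact/negP.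
have {}xz : `|x - c * t - d| < 2 * w.
  by rewrite ltr_norml; move: xz => /andP[? ?]; apply/andP; split; lra.
rewrite DE; apply: le_trans (ler_normD _ _) _.
rewrite (normrM (P (t, x))) (normrM (dpsi t)) (normrM (Q (t, x) - c * P (t, x))).
rewrite (normrM (psi t)).
have chi1 : `|chi (z t x)| <= 1 by rewrite ger0_norm ?plateau_ge0 ?plateau_le1.
have psi1 : `|psi t| <= 1 by rewrite ger0_norm ?psi_ge0 ?psi_le1.
apply: lerD.
  by apply: ler_pM; rewrite ?mulr_ge0 ?P_bnd//; apply: ler_pM.
apply: ler_pM; rewrite ?mulr_ge0//; last by apply: ler_pM.
have [xl|xl|xl] := ltgtP x (Phi t); last by move: xP; rewrite xl eqxx.
- have h := Q_left tab xz xl; rewrite -[X in `|X|](subrK Al).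
  by apply: le_trans (ler_normD _ _) _; have := normr_ge0 Ar; lra.
- have h := Q_right tab xz xl; rewrite -[X in `|X|](subrK Ar).
  by apply: le_trans (ler_normD _ _) _; have := normr_ge0 Al; lra.
Qed.

Let slice_oo t u v : a < t < b -> mu.-integrable `]u, v[ (EFin \o (fun x => D (t, x))).
Proof.
move=> tab; have [K HK] := D_bounded.
exact: (slice_integrable D_cont (fun t x tab (_ : u < x < v) => HK t x tab) tab).
Qed.

(* The window equals 1 on the curve, so its x-derivative integrates to 1 on the left of
   the curve and to -1 on its right. *)
Let G_estimate t : a < t < b ->
  `|G t - psi t * (Al - Ar)| <= 4 * w * M * `|dpsi t| + 2 * kap * psi t.
Proof.
move=> tab; have w0' := w0; pose m := c * t + d.
have /andP[s1 s2] : m - w <= Phi t <= m + w.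
  by have := near_line tab; rewrite ler_norml /m => /andP[? ?]; apply/andP; split; lra.
have us : m - 2 * w <= Phi t by lra.
have sv : Phi t <= m + 2 * w by lra.
have cz : continuous (fun x => dchi (z t x)).
  move=> x; apply: (@continuous_comp _ _ _ (z t) dchi); last exact: continuous_dplateau.
  by apply: cvgB; [apply: cvgB; [exact: cvg_id|exact: cvg_cst]|exact: cvg_cst].
have dz x : is_derive x (1 : R) (fun x => chi (z t x)) (dchi (z t x)).
  have d1 : is_derive x (1 : R) (z t) 1.
    have d0 := is_deriveB (is_deriveB (is_derive_id x (1 : R))
      (is_derive_cst (c * t) x (1 : R))) (is_derive_cst d x (1 : R)).
    by apply: (is_derive_eq d0); rewrite !subr0.
  have d2 := is_derive_plateau (- (2 * w)) (2 * w) w (z t x).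
  by rewrite -[dchi _]mulr1; exact: (@is_derive1_comp _ chi (z t)).
have chiS : chi (z t (Phi t)) = 1 by rewrite /chi plateau_eq1// /z; move: s1 s2; rewrite /m; lra.
have chiU : chi (z t (m - 2 * w)) = 0.
  by apply: plateau_eq0 => //; left; rewrite /z /m; lra.
have chiV : chi (z t (m + 2 * w)) = 0.
  by apply: plateau_eq0 => //; right; rewrite /z /m; lra.
have zin x : m - 2 * w < x -> x < m + 2 * w -> `|x - c * t - d| < 2 * w.
  by rewrite ltr_norml /m => ? ?; apply/andP; split; lra.
have Pchi x : m - 2 * w < x -> x < m + 2 * w -> x != Phi t ->
    `|P (t, x) * (dpsi t * chi (z t x))| <= M * `|dpsi t|.
  move=> ux xv xP; rewrite (normrM (P (t, x))); apply: ler_pM => //; first exact: P_bnd (zin _ ux xv) xP.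
  by rewrite (normrM (dpsi t)) -[leRHS]mulr1 ler_wpM2l// ger0_norm ?plateau_ge0 ?plateau_le1.
have hl := Rintegral_near_derivative (h := fun x => D (t, x)) (A := psi t * Al)
  (B := M * `|dpsi t|) (K := kap * psi t) us cz dz (slice_oo _ _ tab).
(* The factors 1 and 0 are the values of $\chi$ on the curve and at the edge of the window, kept
   unsimplified so that they can be rewritten back. *)
have {}hl : `|\int[mu]_(x in `]m - 2 * w, Phi t[) D (t, x) - psi t * Al * (1 - 0)|
    <= M * `|dpsi t| * (Phi t - (m - 2 * w)) + kap * psi t * (1 - 0).
  rewrite -{2 4}chiS -chiU; apply: hl => x /andP[ux xs].
  have xv : x < m + 2 * w by apply: lt_le_trans xs sv.
  have -> : D (t, x) - psi t * Al * dchi (z t x) = P (t, x) * (dpsi t * chi (z t x)) +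
      (Q (t, x) - c * P (t, x) - Al) * (psi t * dchi (z t x)) by rewrite DE; ring.
  apply: le_trans (ler_normD _ _) _; apply: lerD; first by apply: Pchi => //; rewrite lt_eqF.
  have dc : 0 <= dchi (z t x).
    by apply: dplateau_ge0 => //; rewrite /z; move: s2 xs; rewrite /m; lra.
  rewrite (normrM (_ - Al)) -mulrA (ger0_norm (mulr_ge0 (psi_ge0 t) dc)).
  apply: ler_wpM2r; first exact: mulr_ge0 (psi_ge0 t) dc.
  exact: Q_left (zin _ ux xv) xs.
(* To the right of the curve $\chi$ decreases, so $-\chi$ is used and the weight $-\chi'$ is
   nonnegative. *)
have czN : continuous (fun x => - dchi (z t x)) by move=> x; apply: cvgN; exact: cz.
have dzN x : is_derive x (1 : R) (fun x => - chi (z t x)) (- dchi (z t x)).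
  by apply: is_deriveN.
have hr := Rintegral_near_derivative (h := fun x => D (t, x)) (A := - (psi t * Ar))
  (B := M * `|dpsi t|) (K := kap * psi t) sv czN dzN (slice_oo _ _ tab).
have {}hr : `|\int[mu]_(x in `]Phi t, m + 2 * w[) D (t, x) - - (psi t * Ar) * (- 0 - - 1)|
    <= M * `|dpsi t| * (m + 2 * w - Phi t) + kap * psi t * (- 0 - - 1).
  rewrite -{2 4}chiS -chiV; apply: hr => x /andP[sx xv].
  have ux : m - 2 * w < x by apply: le_lt_trans us sx.
  have -> : D (t, x) - - (psi t * Ar) * - dchi (z t x) = P (t, x) * (dpsi t * chi (z t x)) +
      (Q (t, x) - c * P (t, x) - Ar) * (psi t * dchi (z t x)) by rewrite DE; ring.
  apply: le_trans (ler_normD _ _) _; apply: lerD; first by apply: Pchi => //; rewrite gt_eqF.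
  have dc : dchi (z t x) <= 0.
    by apply: dplateau_le0 => //; rewrite /z; move: s1 sx; rewrite /m; lra.
  rewrite (normrM (_ - Ar)) -mulrA (normrM (psi t)) (ger0_norm (psi_ge0 t)) (ler0_norm dc).
  apply: ler_wpM2r; first by rewrite (mulr_ge0 (psi_ge0 t))// oppr_ge0.
  exact: Q_right (zin _ ux xv) sx.
rewrite G_near -/m (Rintegral_split_oo us sv (slice_oo _ _ tab)).
move: hl hr; set I1 := \int[mu]_(x in _) _; set I2 := \int[mu]_(x in _) _ => hl hr.
rewrite (_ : I1 + I2 - psi t * (Al - Ar) = (I1 - psi t * Al * (1 - 0)) +
  (I2 - - (psi t * Ar) * (- 0 - - 1))); last by ring.
(* The two intervals have total length $4w$, and $|\chi'|$ has mass 1 on each. *)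
apply: le_trans (ler_normD _ _) _; apply: le_trans (lerD hl hr) _.
rewrite le_eqVlt; apply/orP; left; apply/eqP; ring.
Qed.

(** Measurability comes from the continuity of slice integrals, boundedness from [G_estimate]. *)
Let G_integrable : mu.-integrable `]a, b[ (EFin \o G).
Proof.
have [C HC] := dplateau_bounded a b k0; have [K HK] := D_bounded.
apply: (@integrable_bounded_oo _ _ _ _ (4 * w * M * C + 2 * kap + `|Al - Ar|)).
  apply: (@eq_measurable_fun _ _ _ _ _ (fun t => \int[mu]_(x in `](- N), N[) D (t, x))).
    by move=> t; rewrite inE/= in_itv/= => tab; rewrite G_fixed.
  apply: open_continuous_measurable_fun; first exact: interval_open.
  move=> t; rewrite inE/= in_itv/= => tab.
  exact: (slice_integral_continuous D_cont (fun t x tab (_ : - N < x < N) => HK t x tab) tab).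
move=> t tab; rewrite -[X in `|X|](subrK (psi t * (Al - Ar))).
apply: le_trans (ler_normD _ _) _; apply: lerD.
  apply: le_trans (G_estimate tab) _; apply: lerD.
    by rewrite ler_wpM2l ?HC// !mulr_ge0// ltW.
  by rewrite -[leRHS]mulr1 ler_wpM2l ?mulr_ge0.
by rewrite (normrM (psi t)) -[leRHS]mul1r ler_wpM2r// ger0_norm.
Qed.

(** Testing the weak equation with the window gives $\int g\psi' = -\int G$, and [G_estimate] bounds
    $G - \psi(A_l - A_r)$. As $|\psi'|$ has total mass 2 whatever the ramp width, the bound does not
    involve [k]. *)
Lemma weak_ramp_estimate :
  `|\int[mu]_(t in `]a, b[) (g t * dplateau a b k t + (Al - Ar) * plateau a b k t)|
    <= 2 * kap * (b - a) + 8 * w * M.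
Proof.
rewrite -/psi -/dpsi.
have psic : continuous psi by exact: continuous_plateau.
have ipsi : mu.-integrable `]a, b[ (EFin \o (fun t => psi t * (Al - Ar))).
  apply: continuous_integrable_oo => t.
  by apply: cvgM; [exact: psic|exact: cvg_cst].
have igd : mu.-integrable `]a, b[ (EFin \o (fun t => g t * dpsi t)).
  apply: continuous_on_integrable_oo => t tab.
  by apply: cvgM; [exact: g_cont|exact: continuous_dplateau].
have w0' := w0; have hw := weak (test_function_window a b c d k0 w0) _.
have {}hw : \int[mu]_(t in `]a, b[) G t + \int[mu]_(t in `]a, b[) (g t * dpsi t) = 0.
  have sab : ((`]a, b[%classic : set R) `<=` `[0, +oo[%classic)%classic.
    by move=> t /=; rewrite !in_itv/= andbT => /andP[/ltW at_ _]; exact: le_trans (ltW a0) at_.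
  rewrite -hw; last first.
    (* The window vanishes at $t = 0$ because $a > 0$. *)
    by move=> x; rewrite /window plateau_eq0 ?mul0r//=; left; exact: ltW.
  congr (_ + _).
    rewrite /half_plane_integral; apply/esym; apply: Rintegral_support => // t _ tab.
    by apply: G_out => h; apply: tab; rewrite /= in_itv.
  rewrite [RHS](@Rintegral_support _ `]a, b[%classic) //.
    apply: eq_Rintegral => t; rewrite inE/= in_itv/= => tab.
    (* On the curve $\chi = 1$ and $\chi' = 0$, so the delta-derivative of the window is $\psi'$. *)
    rewrite /delta_derivative pd_t_window pd_x_window /=.
    have := near_line tab; rewrite ler_norml => /andP[h1 h2].
    rewrite (@plateau_eq1 _ _ _ _ w0 (_ - _)); [|lra|lra].
    rewrite (@dplateau_flat _ _ _ _ w0 (_ - _)); [|lra|lra].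
    by rewrite !mulr0 subr0 addr0 mulr1.
  move=> t _ /= tab; rewrite /delta_derivative pd_t_window pd_x_window /=.
  have h : t <= a \/ b <= t.
    have [ta|at_] := leP t a; first by left.
    by right; rewrite leNgt; apply/negP => tb; apply: tab; rewrite in_itv/= at_.
  by rewrite (dplateau_eq0 k0 h) (plateau_eq0 k0 h) !mul0r !mulr0 subr0 addr0 mulr0.
pose H t := G t - psi t * (Al - Ar).
have iH : mu.-integrable `]a, b[ (EFin \o H).
  rewrite (_ : _ \o _ = ((EFin \o G) \- (EFin \o (fun t => (psi t * (Al - Ar))%R)))%E)//.
  exact: integrableB.
have -> : \int[mu]_(t in `]a, b[) (g t * dpsi t + (Al - Ar) * psi t) =
    - \int[mu]_(t in `]a, b[) H t.
  rewrite (_ : (fun t => g t * dpsi t + (Al - Ar) * psi t) =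
    (fun t => g t * dpsi t + psi t * (Al - Ar))); last first.
    by apply/funext => t; rewrite (mulrC (psi t)).
  rewrite RintegralD// RintegralB//; lra.
rewrite normrN.
(* Cutting at the midpoint gives $\psi'$ a sign on each half, so that $|\psi'|$ integrates to a
   difference of values of $\psi$. *)
have ab' := ab; have kab' := kab; pose m := (a + b) / 2.
have [am mb] : a <= m /\ m <= b by split; rewrite /m; lra.
have [akm mbk] : a + k <= m /\ m <= b - k by split; rewrite /m; lra.
have pm : psi m = 1 by rewrite /psi plateau_eq1.
have pa : psi a = 0 by apply: plateau_eq0 => //; left.
have pb : psi b = 0 by apply: plateau_eq0 => //; right.
have kp t : 2 * kap * psi t <= 2 * kap by rewrite -[leRHS]mulr1 ler_wpM2l ?mulr_ge0.
rewrite (Rintegral_split_oo am mb iH).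
have cdpsi : continuous dpsi by exact: continuous_dplateau.
have ddpsi : forall t, is_derive t (1 : R) psi (dpsi t) by exact: is_derive_plateau.
have hl := Rintegral_near_derivative (h := H) (A := 0)
  (B := 2 * kap) (K := 4 * w * M) am cdpsi ddpsi.
have {}hl : `|\int[mu]_(t in `]a, m[) H t| <= 2 * kap * (m - a) + 4 * w * M.
  move: hl; rewrite mul0r subr0 pm pa subr0 mulr1; apply.
    by apply: integrableS iH => // t /=; rewrite !in_itv/= => /andP[-> /=] tm; exact: lt_le_trans mb.
  move=> t /andP[at_ tm]; rewrite mul0r subr0 /H.
  have tab : a < t < b by rewrite at_ (lt_le_trans tm).
  apply: le_trans (G_estimate tab) _; rewrite addrC lerD//.
  by rewrite ger0_norm// /dpsi dplateau_ge0//; move: mbk tm; lra.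
have cdpsiN : continuous (fun t => - dpsi t) by move=> t; apply: cvgN; exact: cdpsi.
have ddpsiN t : is_derive t (1 : R) (fun t => - psi t) (- dpsi t) by apply: is_deriveN.
have hr := Rintegral_near_derivative (h := H) (A := 0)
  (B := 2 * kap) (K := 4 * w * M) mb cdpsiN ddpsiN.
have {}hr : `|\int[mu]_(t in `]m, b[) H t| <= 2 * kap * (b - m) + 4 * w * M.
  move: hr; rewrite mul0r subr0 pm pb oppr0 sub0r opprK mulr1; apply.
    by apply: integrableS iH => // t /=; rewrite !in_itv/= => /andP[mt ->]; rewrite (le_lt_trans am mt).
  move=> t /andP[mt tb]; rewrite mul0r subr0 /H.
  have tab : a < t < b by rewrite tb (le_lt_trans am).
  apply: le_trans (G_estimate tab) _; rewrite addrC lerD//.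
  by rewrite ler0_norm// /dpsi dplateau_le0//; move: akm mt; lra.
apply: le_trans (ler_normD _ _) _; apply: le_trans (lerD hl hr) _.
rewrite le_eqVlt; apply/orP; left; apply/eqP; ring.
Qed.

End fixed_ramp.

(** The estimate for a fixed ramp is uniform in the ramp width, which can therefore tend to 0. *)
Lemma weak_increment : `|g b - g a - (Al - Ar) * (b - a)| <= 2 * kap * (b - a) + 8 * w * M.
Proof.
by apply: plateau_limit => // k k0 kab; exact: weak_ramp_estimate.
Qed.

End weak_increment.

(** * Calculus on the half-line and limits at the curve *)

Lemma is_dtP (R : realType) (f : R -> R) (t l : R) :
  is_dt f t l <-> forall e : R, 0 < e -> exists2 r, 0 < r &
    forall s : R, 0 <= s -> `|s - t| < r -> `|f s - f t - l * (s - t)| <= e * `|s - t|.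
Proof.
have quot s : s != t -> (f s - f t) / (s - t) - l = (f s - f t - l * (s - t)) / (s - t).
  by move=> st; rewrite [RHS]mulrBl mulfK// subr_eq0.
split=> [/cvgrPdistC_le H e /H [r /= r0 Hr]|H].
  exists r => // s s0 str; have [->|st] := eqVneq s t.
    by rewrite !subrr mulr0 subrr normr0 mulr0.
  have := Hr s; rewrite /ball/= distrC => /(_ str st s0).
  by rewrite quot// normrM normfV ler_pdivrMr// normr_gt0 subr_eq0.
apply/cvgrPdistC_le => e /H [r r0 Hr]; exists r => //= s.
rewrite /= distrC => str st s0.
by rewrite quot// normrM normfV ler_pdivrMr ?Hr// normr_gt0 subr_eq0.
Qed.

Definition continuous_halfline (R : realType) (g : R -> R) : Prop :=
  forall t : R, 0 <= t -> g s @[s --> within [set s | 0 <= s] (nbhs t)] --> g t.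

Lemma continuous_halflineP (R : realType) (g : R -> R) :
  continuous_halfline g <->
  forall t : R, 0 <= t -> forall e : R, 0 < e -> exists2 r, 0 < r &
    forall s, 0 <= s -> `|s - t| < r -> `|g s - g t| <= e.
Proof.
split=> H t t0.
  move=> e e0; have /cvgrPdistC_le /(_ _ e0) [r /= r0 Hr] := H t t0.
  by exists r => // s s0 st; apply: Hr => //=; rewrite distrC.
apply/cvgrPdistC_le => e e0; have [r r0 Hr] := H t t0 e e0.
by exists r => //= s; rewrite /= distrC => st s0; exact: Hr.
Qed.

Lemma is_dt_continuous (R : realType) (f df : R -> R) :
  (forall t, 0 <= t -> is_dt f t (df t)) -> continuous_halfline f.
Proof.
move=> H; apply/continuous_halflineP => t t0 e e0.
have /is_dtP /(_ 1 ltr01) [r r0 Hr] := H t t0.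
have K0 : 0 < 1 + `|df t| by rewrite ltr_pwDl.
exists (Num.min r (e / (1 + `|df t|))) => [|s s0]; first by rewrite lt_min r0 divr_gt0.
rewrite lt_min ltr_pdivlMr// => /andP[/(Hr _ s0) h1 h2].
rewrite -[X in `|X|](subrK (df t * (s - t))); apply: le_trans (ler_normD _ _) _.
rewrite normrM; lra.
Qed.

Lemma continuous_halfline_interior (R : realType) (g : R -> R) (t : R) :
  continuous_halfline g -> 0 < t -> {for t, continuous g}.
Proof.
move=> /continuous_halflineP H t0; apply/cvgrPdistC_le => e e0.
have [r r0 Hr] := H t (ltW t0) e e0.
exists (Num.min r t); first by rewrite /= lt_min r0.
move=> s /=; rewrite lt_min => /andP[s1 s2]; apply: Hr; last by rewrite distrC.
by move: s2; rewrite ltr_norml => /andP[? ?]; lra.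
Qed.

(** Continuity is asked at $t > 0$ only, since a full neighbourhood of a point with $t = 0$ leaves
    the half-plane. *)
Definition piecewise_continuous (R : realType) (Phi : R -> R) (f : R * R -> R) : Prop :=
  (forall p, 0 < p.1 -> p.2 != Phi p.1 -> {for p, continuous f}) /\
  forall t, 0 <= t -> cvg (f @ left_nbhs Phi t) /\ cvg (f @ right_nbhs Phi t).

Lemma side_lim (R : realType) (S : set (R * R)) (f : R * R -> R) (p : R * R) (e : R) :
  cvg (f @ within S (nbhs p)) -> 0 < e -> exists2 r, 0 < r &
    forall q, S q -> `|q.1 - p.1| < r -> `|q.2 - p.2| < r ->
      `|f q - lim (f @ within S (nbhs p))| <= e.
Proof.
move=> cf e0; have /cvgrPdistC_le /(_ _ e0) := cf.
rewrite /within/= => /nbhs_ballP[r /= r0 Hr]; exists r => // q Sq q1 q2.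
by apply: Hr => //; split; rewrite /ball/= distrC.
Qed.

(** A point $(s, x)$ of [S] close to $(s, \Phi(s))$ is also close to $(t, \Phi(t))$ when $s$ is near
    $t$, so [f] there is within $e/2$ of both limits. The second hypothesis provides such a point on
    every time slice. *)
Lemma side_lim_continuous (R : realType) (Phi : R -> R) (S : set (R * R))
    (f : R * R -> R) : continuous_halfline Phi ->
  (forall t r : R, 0 <= t -> 0 < r -> exists2 x, S (t, x) & `|x - Phi t| < r) ->
  (forall t, 0 <= t -> cvg (f @ within S (nbhs (t, Phi t)))) ->
  continuous_halfline (fun t => lim (f @ within S (nbhs (t, Phi t)))).
Proof.
move=> /continuous_halflineP cPhi acc cf; apply/continuous_halflineP => t t0 e e0.
have e20 : 0 < e / 2 by lra.
have [r1 r10 H1] := side_lim (cf t t0) e20.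
have r120 : 0 < r1 / 2 by lra.
have [r2 r20 H2] := cPhi t t0 _ r120.
exists (Num.min r1 r2) => [|s s0]; first by rewrite lt_min r10.
rewrite lt_min => /andP[s1 s2].
have [r3 r30 H3] := side_lim (cf s s0) e20.
have [|x Sx] := acc s (Num.min r3 (r1 / 2)) s0; first by rewrite lt_min r30.
rewrite lt_min => /andP[x1 x2].
have h1 : `|x - Phi t| < r1.
  have := H2 s s0 s2; rewrite -[x - _](subrKA (Phi s)) => h.
  apply: le_lt_trans (ler_normD _ _) _; lra.
have h3 : `|s - s| < r3 by rewrite subrr normr0.
have k1 := H1 (s, x) Sx s1 h1; have k3 := H3 (s, x) Sx h3 x1.
rewrite distrC -[X in `|X|](subrKA (f (s, x))); apply: le_trans (ler_normD _ _) _.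
by rewrite (distrC _ (f _)); lra.
Qed.

(** * The jump condition at a point of the curve *)

Section jump_condition.
Variables (R : realType) (Phi : R -> R) (P Q : R * R -> R) (g : R -> R) (t0 : R).
Notation mu := (@lebesgue_measure R).
Hypotheses (t00 : 0 <= t0) (dPhi : is_dt Phi t0 (dt Phi t0)).
Hypotheses (Ppc : piecewise_continuous Phi P) (Qpc : piecewise_continuous Phi Q).
Hypothesis g_cont : continuous_halfline g.
Hypothesis weak : forall phi : R * R -> R, test_function phi ->
  (forall x, phi (0, x) = 0) ->
  half_plane_integral (fun p => P p * pd_t phi p + Q p * pd_x phi p)
  + \int[mu]_(t in `[0, +oo[) (g t * delta_derivative Phi phi t) = 0.

Let F := - jump Phi Q t0 + jump Phi P t0 * dt Phi t0.

(** [weak_increment] is applied with the tangent to the curve at [t0] and $w = \delta h$. Its two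
    error terms are each at most $eh/2$: $2 (e/8)(b - a)$ from the fluxes, as $b - a \le 2h$, and $8
    \delta h M$ from the width. *)
Lemma jump_increment e : 0 < e -> exists2 r, 0 < r &
  forall a b h, 0 < a -> a < b -> `|a - t0| <= h -> `|b - t0| <= h -> h < r ->
    `|g b - g a - F * (b - a)| <= e * h.
Proof.
move=> e0; pose c := dt Phi t0.
have [cPl cPr] := Ppc.2 t0 t00; have [cQl cQr] := Qpc.2 t0 t00.
set pl := lim (P @ left_nbhs Phi t0); set pr := lim (P @ right_nbhs Phi t0).
set ql := lim (Q @ left_nbhs Phi t0); set qr := lim (Q @ right_nbhs Phi t0).
pose M := `|pl| + `|pr| + 1.
have M0 : 0 < M by rewrite /M; have := normr_ge0 pl; have := normr_ge0 pr; lra.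
(* The bound $e/(16M)$ makes the width term small; the bound 1 keeps the window of size $O(h)$. *)
pose del := Num.min 1 (e / (16 * M)).
have del0 : 0 < del by rewrite lt_min ltr01 divr_gt0// mulr_gt0.
have del1 : del <= 1 by rewrite ge_min lexx.
have delM : 16 * M * del <= e.
  by rewrite mulrC -ler_pdivlMr ?mulr_gt0// ge_min lexx orbT.
have c10 : 0 < 1 + `|c| by rewrite ltr_pwDl.
(* The bound 1 makes [M] a bound for $P$ near the point. The other one keeps $Q - cP$ within $e/8$
   of its limit once $P$ and $Q$ are within [kap0] of theirs. *)
pose kap0 := Num.min 1 (e / 8 / (1 + `|c|)).
have kap00 : 0 < kap0 by rewrite lt_min ltr01 !divr_gt0.
have kap01 : kap0 <= 1 by rewrite ge_min lexx.
have kap0c : kap0 * (1 + `|c|) <= e / 8 by rewrite -ler_pdivlMr// ge_min lexx orbT.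
have [r1 r10 H1] := side_lim cPl kap00; have [r2 r20 H2] := side_lim cPr kap00.
have [r3 r30 H3] := side_lim cQl kap00; have [r4 r40 H4] := side_lim cQr kap00.
have /is_dtP /(_ _ del0) [r5 r50 H5] := dPhi.
pose r0 := Num.min (Num.min r1 r2) (Num.min r3 r4).
have r00 : 0 < r0 by rewrite !lt_min r10 r20 r30 r40.
(* A point of the window is less than $2\delta h + |c| h \le (2 + |c|) h$ away from $\Phi(t_0)$ in
   $x$ and at most $h$ away from $t_0$ in time; $(3 + |c|) h < r_0$ covers both. *)
have c30 : 0 < 3 + `|c| by rewrite ltr_pwDl.
exists (Num.min r5 (r0 / (3 + `|c|))) => [|a b h a0 ab ah bh].
  by rewrite lt_min r50 divr_gt0.
rewrite lt_min ltr_pdivlMr// => /andP[hr5 hr0].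
have h0 : 0 < h.
  move: ah bh; rewrite !ler_norml => /andP[? ?] /andP[? ?]; lra.
have th t : a < t < b -> `|t - t0| <= h.
  move=> /andP[? ?]; move: ah bh; rewrite !ler_norml => /andP[? ?] /andP[? ?].
  by apply/andP; split; lra.
have line t : a < t < b -> `|Phi t - c * t - (Phi t0 - c * t0)| <= del * h.
  move=> tab; have := H5 t; have -> : Phi t - Phi t0 - dt Phi t0 * (t - t0) =
    Phi t - c * t - (Phi t0 - c * t0) by rewrite /c; ring.
  move=> /(_ _ _)/le_trans; apply.
  - by move: tab => /andP[/ltW]; move: a0 => /ltW /le_trans h1 /h1.
  - exact: le_lt_trans (th t tab) _.
  - by rewrite ler_wpM2l ?th// ltW.
have near_pt t x : a < t < b -> `|x - c * t - (Phi t0 - c * t0)| < 2 * (del * h) ->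
    `|t - t0| < r0 /\ `|x - Phi t0| < r0.
  move=> tab xt; have h1 := th t tab.
  have delh : del * h <= h by rewrite -[leRHS]mul1r ler_wpM2r// ltW.
  have ch0 : 0 <= `|c| * h by rewrite mulr_ge0// ltW.
  split; first by apply: le_lt_trans h1 _; lra.
  have -> : x - Phi t0 = (x - c * t - (Phi t0 - c * t0)) + c * (t - t0) by ring.
  apply: le_lt_trans (ler_normD _ _) _; rewrite normrM.
  have : `|c| * `|t - t0| <= `|c| * h by rewrite ler_wpM2l.
  lra.
have pos t : a < t < b -> 0 < t by move=> /andP[+ _]; exact: lt_trans.
have Pl t x : a < t < b -> `|x - c * t - (Phi t0 - c * t0)| < 2 * (del * h) ->
    x < Phi t -> `|P (t, x) - pl| <= kap0 /\ `|Q (t, x) - ql| <= kap0.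
  move=> tab /(near_pt _ _ tab)[]; rewrite !lt_min.
  move=> /andP[/andP[t1 _] /andP[t3 _]] /andP[/andP[x1 _] /andP[x3 _]] xP.
  by split; [apply: H1|apply: H3] => //; split=> //=; exact/ltW/pos.
have Pr t x : a < t < b -> `|x - c * t - (Phi t0 - c * t0)| < 2 * (del * h) ->
    Phi t < x -> `|P (t, x) - pr| <= kap0 /\ `|Q (t, x) - qr| <= kap0.
  move=> tab /(near_pt _ _ tab)[]; rewrite !lt_min.
  move=> /andP[/andP[_ t1] /andP[_ t3]] /andP[/andP[_ x1] /andP[_ x3]] xP.
  by split; [apply: H2|apply: H4] => //; split=> //=; exact/ltW/pos.
have comb u v u0 v0 : `|u - u0| <= kap0 -> `|v - v0| <= kap0 ->
    `|v - c * u - (v0 - c * u0)| <= e / 8.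
  move=> hu hv; have -> : v - c * u - (v0 - c * u0) = (v - v0) - c * (u - u0) by ring.
  apply: le_trans (ler_normB _ _) _; rewrite normrM.
  have : `|c| * `|u - u0| <= `|c| * kap0 by rewrite ler_wpM2l.
  lra.
have := @weak_increment R Phi P Q g a b (del * h) c (Phi t0 - c * t0)
  (ql - c * pl) (qr - c * pr) M (e / 8) a0 ab (mulr_gt0 del0 h0).
have -> : ql - c * pl - (qr - c * pr) = F by rewrite /F /jump -/pl -/pr -/ql -/qr /c; ring.
move=> WI; apply: le_trans (WI _ _ _ _ _ _ _ _) _ => //.
- by move=> t x tab xP; apply: Ppc.1 => //=; exact: pos tab.
- by move=> t x tab xP; apply: Qpc.1 => //=; exact: pos tab.
- move=> t x tab xt; have [xl|xl|_] := ltgtP x (Phi t); last by [].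
    have [h1 _] := Pl t x tab xt xl; move=> _; rewrite -[X in `|X|](subrK pl).
    by apply: le_trans (ler_normD _ _) _; rewrite /M; have := normr_ge0 pr; lra.
  have [h1 _] := Pr t x tab xt xl; move=> _; rewrite -[X in `|X|](subrK pr).
  by apply: le_trans (ler_normD _ _) _; rewrite /M; have := normr_ge0 pl; lra.
- by move=> t x tab xt xl; have [h1 h2] := Pl t x tab xt xl; exact: comb.
- by move=> t x tab xt xl; have [h1 h2] := Pr t x tab xt xl; exact: comb.
- move=> t /andP[at_ _]; apply: continuous_halfline_interior => //.
  exact: lt_le_trans at_.
- have bah : b - a <= 2 * h.
    move: ah bh; rewrite !ler_norml => /andP[? ?] /andP[? ?]; lra.
  have k1 : 2 * (e / 8) * (b - a) <= 2 * (e / 8) * (2 * h).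
    by rewrite ler_wpM2l//; lra.
  have k2 : 16 * M * del * h <= e * h by rewrite ler_wpM2r// ltW.
  lra.
Qed.

(** [jump_increment] on the interval between [s] and [t0], with $h = |s - t_0|$, has an error $eh$
    that is exactly what differentiability at [t0] allows. *)
Lemma jump_condition : is_dt g t0 F.
Proof.
apply/is_dtP => e e0; have [r r0 Hr] := jump_increment e0.
exists r => // s s0 str.
(* The left endpoint is 0 when [t0] or [s] is 0, whereas [jump_increment] requires $a > 0$. It is
   moved to $a + k$, and continuity of [g] makes the change arbitrarily small. *)
have key a b : 0 <= a -> a < b -> `|a - t0| <= `|s - t0| -> `|b - t0| <= `|s - t0| ->
    `|g b - g a - F * (b - a)| <= e * `|s - t0|.
  move=> a0 ab ah bh; apply/ler_addgt0Pr => eta eta0.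
  have eta20 : 0 < eta / 2 by lra.
  have F10 : 0 < 1 + `|F| by rewrite ltr_pwDl.
  have [r1 r10 H1] := (continuous_halflineP g).1 g_cont a a0 _ eta20.
  pose k := Num.min ((b - a) / 2) (Num.min (r1 / 2) (eta / 2 / (1 + `|F|))).
  have k0 : 0 < k by rewrite !lt_min !divr_gt0// subr_gt0.
  have kab : k <= (b - a) / 2 by rewrite ge_min lexx.
  have kr1 : k <= r1 / 2 by rewrite !ge_min lexx orbT.
  have kF : k * (1 + `|F|) <= eta / 2.
    by rewrite -ler_pdivlMr// !ge_min lexx !orbT.
  have h1 : `|g (a + k) - g a| <= eta / 2.
    by apply: H1; [lra|rewrite (_ : a + k - a = k) ?gtr0_norm//; [lra|ring]].
  have h2 : `|g b - g (a + k) - F * (b - (a + k))| <= e * `|s - t0|.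
    apply: Hr => //; [lra|lra|].
    by move: ah bh; rewrite !ler_norml => /andP[? ?] /andP[? ?]; apply/andP; split; lra.
  have -> : g b - g a - F * (b - a) = (g b - g (a + k) - F * (b - (a + k))) +
    ((g (a + k) - g a) - F * k) by ring.
  apply: le_trans (ler_normD _ _) _; apply: lerD => //.
  apply: le_trans (ler_normB _ _) _; rewrite normrM (gtr0_norm k0); lra.
have [st|st|->] := ltgtP s t0.
- have -> : g s - g t0 - F * (s - t0) = - (g t0 - g s - F * (t0 - s)) by ring.
  by rewrite normrN; apply: key => //; rewrite subrr normr0.
- by apply: key => //; rewrite subrr normr0.
- by rewrite !subrr mulr0 subrr normr0 mulr0.
Qed.

End jump_condition.

(** * Piecewise continuous functions *)

(** For $t > 0$ and off the curve, continuity of [Phi] makes the side containing the point a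
    neighbourhood of it, so [f] agrees near the point with a function differentiable there. *)
Lemma piecewise_differentiable_continuous (R : realType) (Phi : R -> R)
    (f : R * R -> R) : continuous_halfline Phi ->
  piecewise_differentiable Phi f -> piecewise_continuous Phi f.
Proof.
move=> cPhi [dl dr lims]; split => // -[t x] /= t0 xP.
have cgap : {for (t, x), continuous (fun p : R * R => p.2 - Phi p.1)}.
  apply: cvgB; first exact: cvg_snd.
  apply: (@cvg_comp _ _ _ fst Phi _ (nbhs t)); first exact: cvg_fst.
  exact: continuous_halfline_interior.
have near_t : \forall p \near (t, x), 0 < p.1.
  have : (fun p : R * R => p.1) @ (t, x) --> t by exact: cvg_fst.
  by move=> /cvgr_gt /(_ _ t0).
have eq_cont (D : set (R * R)) : differentiable_on D f -> D (t, x) ->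
    (\forall p \near (t, x), D p) -> {for (t, x), continuous f}.
  move=> dD Dtx nD; have [h dh hf] := dD _ Dtx.
  have hc : {for (t, x), continuous h} by exact: differentiable_continuous dh.
  rewrite /prop_for /continuous_at -(hf _ Dtx); apply: cvg_trans hc.
  by apply: near_eq_cvg; apply: filterS nD => p /hf.
have [xl|xl|/eqP] := ltgtP x (Phi t); last by rewrite (negbTE xP).
- apply: (eq_cont _ dl); first by split => //; exact: ltW.
  have gap0 : x - Phi t < 0 by rewrite subr_lt0.
  have := cgap => /cvgr_lt /(_ _ gap0); apply: filterS2 near_t => p p0 /=.
  by rewrite subr_lt0 => pP; split => //; exact: ltW.
- apply: (eq_cont _ dr); first by split => //; exact: ltW.
  have gap0 : 0 < x - Phi t by rewrite subr_gt0.
  have := cgap => /cvgr_gt /(_ _ gap0); apply: filterS2 near_t => p p0 /=.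
  by rewrite subr_gt0 => pP; split => //; exact: ltW.
Qed.

Lemma piecewise_continuous_cst (R : realType) (Phi : R -> R) (k : R) :
  piecewise_continuous Phi (fun=> k).
Proof.
split => [p _ _|t _]; first exact: cvg_cst.
by split; apply/cvg_ex; exists k; exact: cvg_cst.
Qed.

Lemma piecewise_continuousD (R : realType) (Phi : R -> R) (f h : R * R -> R) :
  piecewise_continuous Phi f -> piecewise_continuous Phi h ->
  piecewise_continuous Phi (fun p => f p + h p).
Proof.
move=> [cf lf] [ch lh]; split => [p p0 pP|t t0].
  by apply: cvgD; [exact: cf|exact: ch].
have [/cvg_ex[/= f1 hf1] /cvg_ex[/= f2 hf2]] := lf t t0.
have [/cvg_ex[/= h1 hh1] /cvg_ex[/= h2 hh2]] := lh t t0.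
by split; apply/cvg_ex; [exists (f1 + h1)|exists (f2 + h2)]; exact: cvgD.
Qed.

Lemma piecewise_continuousM (R : realType) (Phi : R -> R) (f h : R * R -> R) :
  piecewise_continuous Phi f -> piecewise_continuous Phi h ->
  piecewise_continuous Phi (fun p => f p * h p).
Proof.
move=> [cf lf] [ch lh]; split => [p p0 pP|t t0].
  by apply: cvgM; [exact: cf|exact: ch].
have [/cvg_ex[/= f1 hf1] /cvg_ex[/= f2 hf2]] := lf t t0.
have [/cvg_ex[/= h1 hh1] /cvg_ex[/= h2 hh2]] := lh t t0.
by split; apply/cvg_ex; [exists (f1 * h1)|exists (f2 * h2)]; exact: cvgM.
Qed.

Lemma piecewise_continuousX (R : realType) (Phi : R -> R) (f : R * R -> R) n :
  piecewise_continuous Phi f -> piecewise_continuous Phi (fun p => f p ^+ n).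
Proof.
move=> cf; elim: n => [|n IH].
  rewrite (_ : (fun p => f p ^+ 0) = fun=> 1); first exact: piecewise_continuous_cst.
  by apply/funext => p; rewrite expr0.
rewrite (_ : (fun p => f p ^+ n.+1) = fun p => f p * f p ^+ n).
  exact: piecewise_continuousM.
by apply/funext => p; rewrite exprS.
Qed.

Lemma jump_continuous (R : realType) (Phi : R -> R) (f : R * R -> R) :
  continuous_halfline Phi ->
  (forall t, 0 <= t -> cvg (f @ left_nbhs Phi t) /\ cvg (f @ right_nbhs Phi t)) ->
  continuous_halfline (jump Phi f).
Proof.
move=> cPhi lims t t0; apply: cvgB.
(* Points at distance $r/2$ from the curve show that each side reaches it on every time slice. *)
- apply: (side_lim_continuous cPhi (S := right_side Phi)) => // [s r s0 r0|s /lims[]//].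
  by exists (Phi s + r / 2); [split => //=; lra|rewrite addrC addKr gtr0_norm; lra].
- apply: (side_lim_continuous cPhi (S := left_side Phi)) => // [s r s0 r0|s /lims[]//].
  by exists (Phi s - r / 2); [split => //=; lra|rewrite addrC addKr normrN gtr0_norm; lra].
Qed.

(** * From the weak equations to the jump conditions *)

Lemma curve_integral_arclength (R : realType) (Phi g : R -> R) :
  curve_integral Phi (fun t => g t / Num.sqrt (1 + dt Phi t ^+ 2)) =
  \int[lebesgue_measure]_(t in `[0, +oo[) g t.
Proof.
apply: eq_Rintegral => t _; rewrite divfK// gt_eqF// sqrtr_gt0.
by rewrite ltr_pwDl// sqr_ge0.
Qed.

Unset Implicit Arguments.
Set Strict Implicit.
Set Printing Implicit Defensive.

Theorem theorem1 (R : realType) (Omega : set (R * R)) (Phi : R -> R)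
    (Vm Vp Em Ep V E nh : R * R -> R) (e : R -> R)
    (hPhi0 : Phi 0 = 0)
    (hPhi : C1_halfline Phi)
    (hOmega_open : exists2 U : set (R * R), open U & Omega = U `&` @half_plane R)
    (hOmega_conn : connected Omega)
    (hOmega_left : Omega `&` left_side Phi !=set0)
    (hOmega_right : Omega `&` right_side Phi !=set0)
    (hV : forall p : R * R, 0 <= p.1 -> p.2 != Phi p.1 ->
       V p = Vm p + (Vp p - Vm p) * Heaviside (p.2 - Phi p.1))
    (hE : forall p : R * R, 0 <= p.1 -> p.2 != Phi p.1 ->
       E p = Em p + (Ep p - Em p) * Heaviside (p.2 - Phi p.1))
    (hnh : forall p : R * R, 0 <= p.1 -> p.2 != Phi p.1 -> nh p = 1 - pd_x E p)
    (he : forall t : R, 0 <= t -> e t = - jump Phi E t)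
    (hVreg : piecewise_differentiable Phi V)
    (hEreg : piecewise_differentiable Phi E)
    (hnhreg : piecewise_differentiable Phi nh)
    (hsol : generalized_solution Phi V E nh e
       (fun x => V (0, x)) (fun x => E (0, x)) (fun x => nh (0, x))) :
  forall t : R, 0 <= t -> Omega (t, Phi t) ->
    is_dt e t
      (- jump Phi (fun p => nh p * V p) t + jump Phi nh t * dt Phi t) /\
    is_dt (fun s => e s * dt Phi s ^+ 2 / 2) t
      (- jump Phi (fun p => nh p * V p ^+ 3 / 2) t
       + jump Phi (fun p => (nh p * V p ^+ 2 + E p ^+ 2) / 2) t * dt Phi t).
Proof.
move=> t t0 _; have [dPhi cdPhi] := hPhi.
have cPhi := is_dt_continuous dPhi.
have cdt : continuous_halfline (dt Phi).
  move=> s s0; have /subspace_continuousP := cdPhi => /(_ s).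
  by rewrite set_itvE; apply.
have pcV := piecewise_differentiable_continuous cPhi hVreg.
have pcE := piecewise_differentiable_continuous cPhi hEreg.
have pcn := piecewise_differentiable_continuous cPhi hnhreg.
(* The amplitude is $-[E]$, so its continuity comes from that of the one-sided limits of $E$ along
   the curve. *)
have ce : continuous_halfline e.
  have /continuous_halflineP cj := jump_continuous cPhi pcE.2.
  apply/continuous_halflineP => s s0 eta eta0; have [r r0 Hr] := cj s s0 eta eta0.
  exists r => // u u0 us; rewrite (he u u0) (he s s0) opprK addrC distrC.
  exact: Hr.
(* For test functions vanishing at $t = 0$ the terms carrying the initial data drop out. *)
have init0 (f phi : R * R -> R) (h : R -> R) : (forall x, phi (0, x) = 0) ->
    \int[lebesgue_measure]_(x in [set: R]) (h x * phi (0, x)) = 0.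
  move=> phi0; rewrite (_ : (fun x => h x * phi (0, x)) = fun=> 0).
    by rewrite Rintegral_cst// mul0r.
  by apply/funext => x; rewrite phi0 mulr0.
split.
(* First equation: $P = \hat n$, $Q = \hat n V$, with amplitude $e$. *)
- apply: (jump_condition t0 (dPhi t t0) pcn (piecewise_continuousM pcn pcV) ce).
  move=> phi tphi phi0 /=; have [+ _] := hsol phi tphi.
  rewrite curve_integral_arclength init0// phi0 mulr0 !addr0; apply: etrans.
  have -> : (fun p => nh p * pd_t phi p + nh p * V p * pd_x phi p) =
      (fun p => nh p * (pd_t phi p + V p * pd_x phi p)); last by [].
  by apply/funext => p; rewrite mulrDr mulrA.
- have pcP : piecewise_continuous Phi (fun p => (nh p * V p ^+ 2 + E p ^+ 2) / 2).
    apply: piecewise_continuousM; last exact: piecewise_continuous_cst.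
    apply: piecewise_continuousD; last exact: piecewise_continuousX.
    by apply: piecewise_continuousM => //; exact: piecewise_continuousX.
  have pcQ : piecewise_continuous Phi (fun p => nh p * V p ^+ 3 / 2).
    apply: piecewise_continuousM; last exact: piecewise_continuous_cst.
    by apply: piecewise_continuousM => //; exact: piecewise_continuousX.
  (* As $\Phi$ is merely $C^1$, only continuity of $e \dot\Phi^2 / 2$ is available beforehand; its
     differentiability is part of the conclusion. *)
  have cg : continuous_halfline (fun s => e s * dt Phi s ^+ 2 / 2).
    move=> s s0; apply: cvgM; last exact: cvg_cst.
    apply: cvgM; first exact: ce.
    by rewrite expr2; apply: cvgM; exact: cdt.
  apply: (jump_condition t0 (dPhi t t0) pcP pcQ cg).
  move=> phi tphi phi0 /=; have [_] := hsol phi tphi.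
  rewrite curve_integral_arclength init0// phi0 mulr0 !addr0; apply: etrans.
  have -> : (fun p => (nh p * V p ^+ 2 + E p ^+ 2) / 2 * pd_t phi p
      + nh p * V p ^+ 3 / 2 * pd_x phi p) =
    (fun p => (nh p * V p ^+ 2 / 2 + E p ^+ 2 / 2) * pd_t phi p
      + nh p * V p ^+ 3 / 2 * pd_x phi p); last by [].
  by apply/funext => p; rewrite (mulrDl (nh p * V p ^+ 2)).
Qed.
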